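(* Let $m\geq1$ and $k$ be integers with $\gcd(m,k)=1$. For $n=4$ or $6$ let $J_n(m,k)=\langle t,y\mid t^n,\ y^{m-k}t^3y^kt^2\rangle$ and $a_n(m,k)=|J_n(m,k)'/J_n(m,k)''|$. Then $$a_4(m,k)=|\mathrm{Res}(1+x^m-x^k,\,1+x^{2m})|=\prod_{\lambda^{2m}=-1}|1+\lambda^m-\lambda^k|=2^m+1-2(\sqrt2)^m\cos((2k-m)\pi/4)$$ and $$a_6(m,k)=|\mathrm{Res}(1+x^m+x^{2m}-x^k-x^{m+k},\,1+x^{3m})|=\prod_{\lambda^{3m}=-1}|1+\lambda^m+\lambda^{2m}-\lambda^k(1+\lambda^m)|=3^m+4^m-2(2\sqrt3)^m\cos((2k-m)\pi/6).$$
   Context: $G'$ denotes the derived subgroup of a group $G$ and $G''=(G')'$. $\mathrm{Res}$ denotes the resultant of polynomials; for $g$ monic, $|\mathrm{Res}(f,g)|=\prod_{g(\lambda)=0}|f(\lambda)|$, the product being over the complex roots of $g$. The products in the claim are over all complex numbers $\lambda$ with the indicated property. If a negative exponent occurs in $f$, then $|\mathrm{Res}(f,g)|$ is understood via this product formula (equivalently, $k$ may be replaced by a non-negative residue modulo $nm$). *)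

(* Defs.v *)
From HB Require Import structures.
From mathcomp Require Import all_boot all_order all_algebra.
From mathcomp Require Import boolp classical_sets.

Set Implicit Arguments.
Unset Strict Implicit.
Unset Printing Implicit Defensive.

Local Open Scope classical_set_scope.
Local Open Scope quotient_scope.

(* Words over the alphabet X: the letter (x, false) stands for x and (x, true)
   for the formal inverse of x. *)
Notation word X := (seq (X * bool)).

Definition letter_inv (X : Type) (a : X * bool) : X * bool := (a.1, ~~ a.2).

Definition word_inv (X : Type) (w : word X) : word X :=
  rev [seq letter_inv a | a <- w].

Definition word_expz (X : Type) (x : X) (e : int) : word X :=
  nseq `|e|%N (x, (e < 0)%R).

(* Equality in the group < X | rels >: the equivalence relation generated by
   the free insertion or deletion of a pair of mutually inverse letters and of
   a relator, anywhere in a word. *)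
Inductive pres_eq (X : Type) (rels : set (word X)) : word X -> word X -> Prop :=
| pres_eq_refl w : pres_eq rels w w
| pres_eq_sym v w : pres_eq rels v w -> pres_eq rels w v
| pres_eq_trans u v w : pres_eq rels u v -> pres_eq rels v w -> pres_eq rels u w
| pres_eq_cancel u a v : pres_eq rels (u ++ [:: a; letter_inv a] ++ v) (u ++ v)
| pres_eq_rel u r v : rels r -> pres_eq rels (u ++ r ++ v) (u ++ v).

Lemma pres_eq_catl (X : Type) (rels : set (word X)) w u v :
  pres_eq rels u v -> pres_eq rels (w ++ u) (w ++ v).
Proof.
elim=> {u v} [u|u v _|u v x _ IH1 _ IH2|u a v|u r v rr].
- exact: pres_eq_refl.
- exact: pres_eq_sym.
- exact: pres_eq_trans IH1 IH2.
- by rewrite !(catA w u); exact: pres_eq_cancel.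
- by rewrite !(catA w u); exact: pres_eq_rel.
Qed.

Lemma pres_eq_catr (X : Type) (rels : set (word X)) w u v :
  pres_eq rels u v -> pres_eq rels (u ++ w) (v ++ w).
Proof.
elim=> {u v} [u|u v _|u v x _ IH1 _ IH2|u a v|u r v rr].
- exact: pres_eq_refl.
- exact: pres_eq_sym.
- exact: pres_eq_trans IH1 IH2.
- by rewrite -!catA; exact: pres_eq_cancel.
- by rewrite -!catA; exact: pres_eq_rel.
Qed.

Lemma pres_eq_cat (X : Type) (rels : set (word X)) u u' v v' :
  pres_eq rels u u' -> pres_eq rels v v' -> pres_eq rels (u ++ v) (u' ++ v').
Proof.
by move=> /(pres_eq_catr v) uu' /(pres_eq_catl u'); exact: pres_eq_trans.
Qed.

Lemma letter_invK (X : Type) : involutive (@letter_inv X).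
Proof. by case=> x b; rewrite /letter_inv /= negbK. Qed.

Lemma word_invK (X : Type) : involutive (@word_inv X).
Proof.
move=> w; rewrite /word_inv map_rev revK -map_comp -[RHS]map_id.
by apply: eq_map => a /=; exact: letter_invK.
Qed.

Lemma word_inv_cat (X : Type) (u v : word X) :
  word_inv (u ++ v) = word_inv v ++ word_inv u.
Proof. by rewrite /word_inv map_cat rev_cat. Qed.

Lemma pres_eq_mulwV (X : Type) (rels : set (word X)) w :
  pres_eq rels (w ++ word_inv w) [::].
Proof.
elim: w => [|a w IH]; first exact: pres_eq_refl.
rewrite -(cat1s a w) word_inv_cat -catA (catA w).
apply: pres_eq_trans (pres_eq_cancel rels [::] a [::]).
exact: (pres_eq_catl [:: a] (pres_eq_catr [:: letter_inv a] IH)).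
Qed.

Lemma pres_eq_mulVw (X : Type) (rels : set (word X)) w :
  pres_eq rels (word_inv w ++ w) [::].
Proof. by rewrite -{2}(word_invK w); exact: pres_eq_mulwV. Qed.

Lemma pres_eq_inv (X : Type) (rels : set (word X)) u v :
  pres_eq rels u v -> pres_eq rels (word_inv u) (word_inv v).
Proof.
move=> uv.
have h1 : pres_eq rels (word_inv u ++ v ++ word_inv v) (word_inv u).
  rewrite -[X in pres_eq _ _ X]cats0.
  exact: pres_eq_catl (pres_eq_mulwV rels v).
have h2 : pres_eq rels (word_inv u ++ v) [::].
  apply: pres_eq_trans (pres_eq_mulVw rels u).
  by apply: pres_eq_catl; exact: pres_eq_sym.
apply: pres_eq_trans (pres_eq_sym h1) _; rewrite catA.
exact: (pres_eq_catr (word_inv v) h2).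
Qed.

Definition pres_eqb (X : choiceType) (rels : set (word X)) : rel (word X) :=
  fun u v => `[< pres_eq rels u v >].

Lemma pres_eqb_refl (X : choiceType) (rels : set (word X)) :
  reflexive (pres_eqb rels).
Proof. by move=> w; apply/asboolP; exact: pres_eq_refl. Qed.

Lemma pres_eqb_sym (X : choiceType) (rels : set (word X)) :
  symmetric (pres_eqb rels).
Proof. by move=> u v; apply/asboolP/asboolP; exact: pres_eq_sym. Qed.

Lemma pres_eqb_trans (X : choiceType) (rels : set (word X)) :
  transitive (pres_eqb rels).
Proof.
by move=> v u w /asboolP uv /asboolP vw; apply/asboolP; exact: pres_eq_trans vw.
Qed.

Canonical pres_equiv (X : choiceType) (rels : set (word X)) :=
  EquivRel (pres_eqb rels) (@pres_eqb_refl X rels) (@pres_eqb_sym X rels)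
           (@pres_eqb_trans X rels).

Definition presented (X : choiceType) (rels : set (word X)) : Type :=
  {eq_quot (pres_equiv rels)}.

HB.instance Definition _ (X : choiceType) (rels : set (word X)) :=
  Choice.copy (presented rels) {eq_quot (pres_equiv rels)}.

Definition pres_pi (X : choiceType) (rels : set (word X)) (w : word X) :
  presented rels := \pi_({eq_quot (pres_equiv rels)}) w.

Definition pres_repr (X : choiceType) (rels : set (word X))
  (g : presented rels) : word X :=
  repr (g : {eq_quot (pres_equiv rels)}).

Lemma pres_reprK (X : choiceType) (rels : set (word X)) :
  cancel (@pres_repr X rels) (@pres_pi X rels).
Proof. by move=> g; exact: reprK. Qed.

Lemma pres_piP (X : choiceType) (rels : set (word X)) u v :
  pres_pi rels u = pres_pi rels v <-> pres_eq rels u v.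
Proof. by split=> [/eqmodP/asboolP|uv] //; apply/eqmodP/asboolP. Qed.

Lemma pres_repr_pi (X : choiceType) (rels : set (word X)) w :
  pres_eq rels (pres_repr (pres_pi rels w)) w.
Proof. by apply/pres_piP; rewrite pres_reprK. Qed.

Definition pres_mul (X : choiceType) (rels : set (word X))
  (g h : presented rels) : presented rels :=
  pres_pi rels (pres_repr g ++ pres_repr h).

Definition pres_inv (X : choiceType) (rels : set (word X))
  (g : presented rels) : presented rels :=
  pres_pi rels (word_inv (pres_repr g)).

Lemma pres_mulE (X : choiceType) (rels : set (word X)) u v :
  pres_mul (pres_pi rels u) (pres_pi rels v) = pres_pi rels (u ++ v).
Proof. by apply/pres_piP; apply: pres_eq_cat; exact: pres_repr_pi. Qed.

Lemma pres_invE (X : choiceType) (rels : set (word X)) u :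
  pres_inv (pres_pi rels u) = pres_pi rels (word_inv u).
Proof. by apply/pres_piP; apply: pres_eq_inv; exact: pres_repr_pi. Qed.

Lemma pres_mulA (X : choiceType) (rels : set (word X)) :
  associative (@pres_mul X rels).
Proof.
move=> f g h; rewrite -(pres_reprK f) -(pres_reprK g) -(pres_reprK h).
by rewrite !pres_mulE catA.
Qed.

Lemma pres_mul1g (X : choiceType) (rels : set (word X)) :
  left_id (pres_pi rels [::]) (@pres_mul X rels).
Proof. by move=> g; rewrite -(pres_reprK g) pres_mulE. Qed.

Lemma pres_mulg1 (X : choiceType) (rels : set (word X)) :
  right_id (pres_pi rels [::]) (@pres_mul X rels).
Proof. by move=> g; rewrite -(pres_reprK g) pres_mulE cats0. Qed.

Lemma pres_mulVg (X : choiceType) (rels : set (word X)) :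
  left_inverse (pres_pi rels [::]) (@pres_inv X rels) (@pres_mul X rels).
Proof.
move=> g; rewrite -(pres_reprK g) pres_invE pres_mulE.
by apply/pres_piP; exact: pres_eq_mulVw.
Qed.

Lemma pres_mulgV (X : choiceType) (rels : set (word X)) :
  right_inverse (pres_pi rels [::]) (@pres_inv X rels) (@pres_mul X rels).
Proof.
move=> g; rewrite -(pres_reprK g) pres_invE pres_mulE.
by apply/pres_piP; exact: pres_eq_mulwV.
Qed.

HB.instance Definition _ (X : choiceType) (rels : set (word X)) :=
  isGroup.Build (presented rels) (@pres_mulA X rels) (@pres_mul1g X rels)
    (@pres_mulg1 X rels) (@pres_mulVg X rels) (@pres_mulgV X rels).

Definition pres_gen (X : choiceType) (rels : set (word X)) (x : X) :
  presented rels := pres_pi rels [:: (x, false)].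

Local Open Scope group_scope.

Definition word_eval (G : groupType) (X : Type) (f : X -> G) (w : word X) : G :=
  \prod_(a <- w) (if a.2 then (f a.1)^-1 else f a.1).

Lemma word_eval_gen (X : choiceType) (rels : set (word X)) (w : word X) :
  word_eval (pres_gen rels) w = pres_pi rels w.
Proof.
rewrite /word_eval; elim: w => [|[x b] w IH]; first by rewrite big_nil.
rewrite big_cons IH /=.
have -> : (if b then (pres_gen rels x)^-1 else pres_gen rels x) =
          pres_pi rels [:: (x, b)].
  by case: b => //; exact: (pres_invE rels [:: (x, false)]).
exact: pres_mulE.
Qed.

(* The two halves of the universal property of < X | rels >. *)
Lemma pres_gen_rel (X : choiceType) (rels : set (word X)) (r : word X) :
  rels r -> word_eval (pres_gen rels) r = 1.
Proof.
move=> rr; rewrite word_eval_gen; apply/pres_piP.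
by have := @pres_eq_rel X rels [::] r [::] rr; rewrite /= cats0.
Qed.

Lemma pres_universal (X : choiceType) (rels : set (word X)) (G : groupType)
    (f : X -> G) :
  (forall r, rels r -> word_eval f r = 1) ->
  exists! phi : presented rels -> G,
    {morph phi : g h / g * h} /\ (forall x, phi (pres_gen rels x) = f x).
Proof.
move=> fr; have evalD u v : word_eval f (u ++ v) = word_eval f u * word_eval f v.
  by rewrite /word_eval big_cat.
have evalE u v : pres_eq rels u v -> word_eval f u = word_eval f v.
  elim=> {u v} [//|//|u v w _ -> _ -> //|u a v|u r v rr]; rewrite !evalD.
    suff -> : word_eval f [:: a; letter_inv a] = 1 by rewrite mul1g.
    rewrite /word_eval !big_cons big_nil mulg1 /=.
    by case: a.2; rewrite (mulVg, mulgV).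
  by rewrite (fr _ rr) mul1g.
exists (fun g => word_eval f (pres_repr g)); split.
  split=> [g h|x]; first by rewrite (evalE _ _ (pres_repr_pi _ _)) evalD.
  by rewrite (evalE _ _ (pres_repr_pi _ _)) /word_eval big_seq1.
move=> phi [phiM phig]; apply/funext => g; rewrite -{2}(pres_reprK g).
have phi1 : phi 1 = 1 by apply: (mulgI (phi 1)); rewrite -phiM !mulg1.
have phiV h : phi h^-1 = (phi h)^-1.
  by apply: (mulgI (phi h)); rewrite -phiM !mulgV.
rewrite -word_eval_gen /word_eval (big_morph phi phiM phi1).
by apply: eq_bigr => -[x []] _ /=; rewrite ?phiV phig.
Qed.

Definition is_subgroup (G : groupType) (H : set G) : Prop :=
  [/\ H 1, forall x y, H x -> H y -> H (x * y) & forall x, H x -> H x^-1].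

Definition gen_subgroup (G : groupType) (A : set G) : set G :=
  smallest (@is_subgroup G) A.

Definition derived (G : groupType) (H : set G) : set G :=
  gen_subgroup [set z | exists x y, [/\ H x, H y & z = [~ x, y]]].

Definition lcosets (G : groupType) (A H : set G) : set (set G) :=
  [set [set x * h | h in H] | x in A].

(* G' / G'' as the set of cosets of G'' in G'. *)
Definition derived_quotient (G : groupType) : set (set G) :=
  let G1 := derived [set: G] in lcosets G1 (derived G1).

Arguments derived_quotient G : clear implicits.

Local Close Scope group_scope.
Local Open Scope ring_scope.

(* < t, y | t^n, y^(m-k) t^3 y^k t^2 >, with t := false and y := true. *)
Definition J_rels (n m : nat) (k : int) : set (word bool) :=
  let t := word_expz false in
  let y := word_expz true in
  [set w | w = t n%:Z \/ w = y (m%:Z - k) ++ t 3 ++ y k ++ t 2].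

Definition J (n m : nat) (k : int) : groupType := presented (J_rels n m k).

(* Main.v *)
Require Import Defs.
From HB Require Import structures.
From mathcomp Require Import all_boot all_order all_algebra separable.
From mathcomp Require Import ring lra zify.
From mathcomp Require Import boolp classical_sets functions cardinality fsbigop.
From mathcomp Require Import reals trigo.
From mathcomp Require Import complex.

(** Put [z = y^-1] for [n = 4] and [z = y] for [n = 6].  In the abelianisation of
    [J] one has [t = z^m], so [J / J'] is cyclic of order [n m], generated by [z],
    and [J' / J''] is generated, as a module over [Z[x]] with [x] acting as
    conjugation by [z], by the class of [tau = t z^-m].  Fox calculus on the two
    relators shows that the annihilator of [tau] is the ideal [(f, g)] of the
    resultant in the statement: the relators give [(x - 1) T] and [D - T], with
    [T = 1 + x^m + ... + x^((n-1)m)] and [D] the Fox derivative of the second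
    relator; as [D - T] takes the value [5 - n = +-1] at [x = 1], the ideal they
    generate contains [T], and it is then equal to [(f, g)].

    [Z[x] / (f, g)] is the cokernel of the Sylvester matrix, so that by the Smith
    normal form it has [|Res (f, g)|] elements.  Multiplying the Sylvester matrix
    by a Vandermonde block turns the resultant into the product of the values of
    [f] at the roots of [g].  Grouping these roots by [zeta = l^m], and using that
    [l |-> l^k] is a bijection from the [m]-th roots of [zeta] onto those of
    [zeta^k], this product becomes the product over [zeta] of
    [a^m - b^m zeta^k], where [f(l) = a - b l^k]. *)

Set Implicit Arguments.
Unset Strict Implicit.
Unset Printing Implicit Defensive.

Import Order.TTheory GRing.Theory Num.Theory.

Local Open Scope classical_set_scope.
Local Open Scope card_scope.
Local Open Scope complex_scope.
Local Open Scope ring_scope.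

(** * Counting Z[x]/(f, g) by the resultant *)

(** The Sylvester matrix stacks the matrices of multiplication by [p] and by [q]; the heights of the
    two blocks bound the degrees of the multipliers, so that no product is truncated. *)
Lemma rVpoly_mul_Sylvester (R : nzRingType) (p q : {poly R})
    (u : 'rV[R]_((size q).-1 + (size p).-1)) :
  rVpoly (u *m Sylvester_mx p q) =
    rVpoly (lsubmx u) * p + rVpoly (rsubmx u) * q.
Proof.
have szM a b (r : {poly R}) (v : 'rV[R]_a) : b = (a + (size r).-1)%N ->
    (size (rVpoly v * r)%R <= b)%N.
  move=> ->; have [->|rn0] := eqVneq r 0; first by rewrite mulr0 size_poly0.
  apply: leq_trans (size_polyMleq _ _) _.
  rewrite -[X in (_ + X).-1%N](@prednK (size r)) ?size_poly_gt0 // addnS /=.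
  by rewrite leq_add2r size_poly.
rewrite -[u in LHS]hsubmxK mul_row_col !mul_rV_lin1 /= linearD /= !poly_rV_K //.
  by rewrite szM // addnC.
by rewrite szM.
Qed.

Section Residues.
Import Pdiv.CommonRing Pdiv.RingMonic.

(** The degree bounds on the multipliers lose nothing: [a] is reduced modulo the monic [q], [b]
    absorbs the quotient, and the new [b] is short because its product with [q] is. *)
Lemma Sylvester_rows (R : idomainType) (p q : {poly R})
    (v : 'rV[R]_((size q).-1 + (size p).-1)) :
  q \is monic -> p != 0 ->
  (exists w, v = w *m Sylvester_mx p q) <->
  (exists a b, rVpoly v = a * p + b * q).
Proof.
move=> qmon pn0; split=> [[w ->]|[a [b vE]]].
  by rewrite rVpoly_mul_Sylvester; do 2!eexists.
have qn0 := monic_neq0 qmon.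
pose a' := rmodp a q; pose b' := b + rdivp a q * p.
have aE : a = rdivp a q * q + a' by exact: rdivp_eq.
have vE' : rVpoly v = a' * p + b' * q.
  by rewrite vE {1}aE /b'; ring.
have a's : (size a' <= (size q).-1)%N.
  rewrite -ltnS prednK ?size_poly_gt0 //; exact: ltn_rmodpN0.
have b's : (size b' <= (size p).-1)%N.
  have [->|b'n0] := eqVneq b' 0; first by rewrite size_poly0.
  have : (size (b' * q)%R <= (size q).-1 + (size p).-1)%N.
    have -> : b' * q = rVpoly v - a' * p by rewrite vE' addrAC subrr add0r.
    rewrite (leq_trans (size_polyD _ _)) // geq_max size_poly size_polyN /=.
    apply: leq_trans (size_polyMleq _ _) _.
    rewrite -[X in (_ + X).-1%N](@prednK (size p)) ?size_poly_gt0 //.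
    by rewrite addnS /= leq_add2r.
  rewrite size_Mmonic // -[X in (_ + X).-1%N](@prednK (size q)) ?size_poly_gt0 //.
  by rewrite addnS /= addnC leq_add2l.
exists (row_mx (poly_rV a') (poly_rV b')).
apply: (can_inj (@rVpolyK _ _)); rewrite rVpoly_mul_Sylvester vE'.
by rewrite row_mxKl row_mxKr !poly_rV_K.
Qed.

(** With [S = L D R], [L] and [R] unimodular and [D] diagonal, the class of [v] modulo the rows of
    [S] is the tuple of residues of the entries of [v R^-1] modulo the [d_i]; there are [|det S|]
    such tuples, and [c] numbers them. *)
Lemma row_lattice_residues (n : nat) (S : 'M[int]_n) : \det S != 0 ->
  exists c : 'rV[int]_n -> nat,
    [/\ forall v, (c v < `|\det S|)%N,
        forall i, (i < `|\det S|)%N -> exists v, c v = i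
      & forall v w, c v = c w <-> exists u, v - w = u *m S].
Proof.
move=> Sn0; have [L Lu [R Ru [d _ SE]]] := int_Smith_normal_form S.
set D := (X in L *m X *m R) in SE.
have DE : D = diag_mx (\row_i d`_i).
  by apply/matrixP=> i j; rewrite !mxE (inj_eq val_inj).
have abs_unit (M : 'M[int]_n) : M \in unitmx -> `|\det M|%N = 1%N.
  by rewrite unitmxE; case/orP => /eqP ->.
have detS : `|\det S|%N = (\prod_(i < n) `|(d`_i)%R|)%N.
  rewrite SE DE !det_mulmx !abszM (abs_unit _ Lu) (abs_unit _ Ru) mul1n muln1 det_diag.
  elim/big_ind2: _ => // [x a y b <- <-|i _]; last by rewrite mxE.
  by rewrite abszM.
have dn0 (i : 'I_n) : d`_i != 0.
  apply: contraNneq Sn0 => di0; rewrite -absz_eq0 detS (bigD1 i) //=.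
  by rewrite di0 mul0n.
pose T := fprod (fun i : 'I_n => 'I_(`|(d`_i)%R|)%N).
have cardT : #|T| = `|\det S|%N.
  by rewrite card_fprod detS; apply: eq_bigr => i _; rewrite card_ord.
have rP (v : 'rV[int]_n) (i : 'I_n) : (`|((v *m invmx R) 0%R i %% (d`_i)%R)%Z| < `|(d`_i)%R|)%N.
  by rewrite -ltz_nat gez0_abs ?modz_ge0 // ltz_mod.
pose r v : T := [fprod i => Ordinal (rP v i)].
have rE v w : r v = r w <-> exists u, v - w = u *m S.
  have -> : (exists u, v - w = u *m S) <->
            (exists u, (v - w) *m invmx R = u *m D).
    split=> [[u uE]|[u uE]].
      by exists (u *m L); rewrite uE SE !mulmxA mulmxK.
    exists (u *m invmx L); rewrite SE !mulmxA mulmxKV // -uE.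
    by rewrite mulmxKV.
  have subE i : ((v - w) *m invmx R) 0 i =
                (v *m invmx R) 0 i - (w *m invmx R) 0 i.
    by rewrite mulmxBl mxE [X in _ + X]mxE.
  have mulDE (u : 'rV[int]_n) i : (u *m D) 0 i = u 0 i * d`_i.
    by rewrite DE mul_mx_diag !mxE.
  split=> [rvw|[u uE]].
    exists (\row_i (((v - w) *m invmx R) 0%R i %/ (d`_i)%R)%Z).
    apply/rowP=> i; rewrite mulDE mxE divzK // subE -eqz_mod_dvd; apply/eqP.
    have := congr1 (fun g : T => val (g i)) rvw.
    by rewrite !fprodE /= => /(congr1 Posz); rewrite !gez0_abs ?modz_ge0.
  apply/(fprodP (r v)) => i; rewrite !fprodE; apply/val_inj; congr absz => /=.
  apply/eqP; rewrite eqz_mod_dvd; apply/dvdzP; exists (u 0 i).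
  by rewrite -subE uE mulDE.
exists (fun v => enum_rank (r v) : nat); split.
- by move=> v; rewrite -cardT.
- move=> i; rewrite -cardT => ilt.
  pose g := enum_val (Ordinal ilt : 'I_#|T|).
  exists ((\row_j (g j : nat)%:Z) *m R).
  suff -> : r ((\row_j (g j : nat)%:Z) *m R) = g by rewrite enum_valK.
  apply/fprodP=> j; rewrite fprodE; apply/val_inj => /=.
  rewrite mulmxK // mxE -modz_abs modz_small ?absz_nat //=.
  by rewrite ltz_nat.
- move=> v w; rewrite -rE; split=> [/val_inj/enum_rank_inj //|-> //].
Qed.

(** A polynomial is replaced by its remainder modulo [g], which is short enough to be a row vector,
    and this vector is classified modulo the rows of the Sylvester matrix. *)
Lemma ideal_residues (f g : {poly int}) :
  g \is monic -> f != 0 -> resultant f g != 0 ->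
  exists c : {poly int} -> nat,
    [/\ forall p, (c p < `|resultant f g|)%N,
        forall i, (i < `|resultant f g|)%N -> exists p, c p = i
      & forall p q, c p = c q <-> exists a b, p - q = a * f + b * g].
Proof.
move=> gmon fn0 Rn0; have [c [c_lt c_surj cE]] := row_lattice_residues Rn0.
have gn0 := monic_neq0 gmon.
pose res p : 'rV[int]_((size g).-1 + (size f).-1) := poly_rV (rmodp p g).
have resK p : rVpoly (res p) = rmodp p g.
  apply: poly_rV_K; rewrite (leq_trans _ (leq_addr _ _)) // -ltnS.
  by rewrite prednK ?size_poly_gt0 // ltn_rmodpN0.
have resB p q : (exists u, res p - res q = u *m Sylvester_mx f g) <->
                (exists a b, p - q = a * f + b * g).
  rewrite Sylvester_rows // linearB /= !resK.
  rewrite [in X in _ <-> X](rdivp_eq gmon p) [in X in _ <-> X](rdivp_eq gmon q).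
  set r := rmodp p g; set s := rmodp q g; set u := rdivp _ _; set v := rdivp _ _.
  split=> [[a [b E]]|[a [b E]]].
    exists a, (b + (u - v)).
    by transitivity ((u - v) * g + (r - s)); [ring | rewrite E; ring].
  exists a, (b - (u - v)).
  by transitivity (u * g + r - (v * g + s) - (u - v) * g); [ring | rewrite E; ring].
exists (c \o res); split=> [p|i /c_surj[v <-]|p q] //=; last by rewrite cE resB.
(* The row [v] may be longer than a remainder, but it differs from its own remainder by a multiple
   of [g], hence by a lattice vector. *)
exists (rVpoly v); apply/cE/Sylvester_rows => //.
rewrite linearB /= resK {2}(rdivp_eq gmon (rVpoly v)).
by exists 0, (- rdivp (rVpoly v) g); rewrite mul0r add0r opprD addrCA subrr addr0 mulNr.
Qed.

End Residues.

(** * The resultant as a product over roots *)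

Lemma row_Sylvester (R : nzRingType) (p q : {poly R}) i :
  rVpoly (row i (Sylvester_mx p q)) =
    match fintype.split i with inl k => 'X^k * p | inr k => 'X^k * q end.
Proof.
rewrite rowE rVpoly_mul_Sylvester; case: split_ordP => j ->.
  by rewrite delta_mx_lshift row_mxKl row_mxKr linear0 mul0r addr0 rVpoly_delta.
by rewrite delta_mx_rshift row_mxKl row_mxKr linear0 mul0r add0r rVpoly_delta.
Qed.

(** The Sylvester matrix is multiplied by the block matrix [[V 0; Y 1]], whose left columns hold the
    powers of the [z_j]. These columns evaluate the rows [X^k f] and [X^k g] at roots of [g], which
    leaves [V diag(f(z_j))] above [0]. *)
Lemma resultant_Vandermonde (R : comNzRingType) (f g : {poly R})
    (z : 'rV[R]_(size g).-1) :
  g \is monic -> (forall j, root g (z 0 j)) ->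
  resultant f g * \det (Vandermonde (size g).-1 z) =
    \det (Vandermonde (size g).-1 z) * \prod_j f.[z 0 j].
Proof.
move=> gmon groot; rewrite /resultant; set V := Vandermonde _ z.
set S := Sylvester_mx f g; set d := (size g).-1; set e := (size f).-1.
pose Y : 'M[R]_(e, d) := \matrix_(k, j) z 0 j ^+ (d + k).
pose E := \matrix_(k < d + e, j < d) z 0 j ^+ k.
have EE : E = col_mx V Y.
  by apply/matrixP=> i j; rewrite !mxE; case: split_ordP => k ->; rewrite !mxE.
have SE i j : (S *m E) i j = (rVpoly (row i S)).[z 0 j].
  rewrite (@horner_coef_wide _ (d + e)) ?size_poly // mxE; apply: eq_bigr => k _.
  by rewrite coef_rVpoly_ord !mxE.
have {}SE : S *m E = col_mx (V *m diag_mx (\row_j f.[z 0 j])) 0.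
  apply/matrixP=> i j; rewrite SE row_Sylvester mxE.
  case: split_ordP => k _; last by rewrite mxE hornerM (eqP (groot j)) mulr0.
  by rewrite mul_mx_diag !mxE hornerM hornerXn mulrC.
transitivity (\det (S *m block_mx V 0 Y 1%:M)).
  by rewrite det_mulmx det_lblock det1 mulr1.
rewrite block_mxEh -EE mul_mx_row SE -[S *m col_mx _ _]vsubmxK -block_mxEh.
rewrite det_ublock det_mulmx det_diag.
have subE i j : dsubmx (S *m col_mx (0 : 'M_(d, e)) 1%:M) i j = ('X^i * g)`_(d + j).
  rewrite mxE -{1}[S]vsubmxK mul_col_mx col_mxEd.
  rewrite -[dsubmx S]hsubmxK mul_row_col mulmx0 add0r mulmx1 2!mxE.
  have := @row_Sylvester _ f g (rshift d i); rewrite -/S (unsplitK (inr i)) => <-.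
  by rewrite (coef_rVpoly_ord _ (rshift d j)) [RHS]mxE.
(* The lower right block holds the coefficients of the [X^i g] from degree [d] on: it is triangular,
   with the leading coefficient 1 of [g] on the diagonal. *)
rewrite [X in _ * X]det_trig; last first.
  apply/is_trig_mxP => i j ij; rewrite subE coefXnM ifN; last first.
    by rewrite -leqNgt (leq_trans (ltnW ij)) ?leq_addl.
  apply: nth_default; rewrite -(@prednK (size g)) ?size_poly_gt0 ?monic_neq0 //.
  by rewrite -addnBA ?(ltnW ij) // -addn1 leq_add2l subn_gt0.
rewrite [X in _ * X]big1 ?mulr1 => [|i _].
  by congr (_ * _); apply: eq_bigr => j _; rewrite mxE.
rewrite subE coefXnM ifN ?addnK; first exact/eqP.
by rewrite -leqNgt leq_addl.
Qed.

Lemma resultant_prod_roots (F : fieldType) (f : {poly F}) (s : seq F) :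
  uniq s -> resultant f (\prod_(z <- s) ('X - z%:P)) = \prod_(z <- s) f.[z].
Proof.
move=> s_uniq; set g := \prod_(z <- s) _.
have gmon : g \is monic by apply: monic_prod_XsubC.
have ds : (size g).-1 = size s by rewrite size_prod_XsubC.
pose z : 'rV[F]_(size g).-1 := \row_j s`_j.
have zroot j : root g (z 0 j).
  by rewrite root_prod_XsubC mxE mem_nth // -ds.
have Vn0 : \det (Vandermonde (size g).-1 z) != 0.
  rewrite det_Vandermonde; apply/prodf_neq0 => i _; apply/prodf_neq0 => j ij.
  by rewrite subr_eq0 !mxE nth_uniq -?ds // gtn_eqF.
apply: (mulIf Vn0); rewrite resultant_Vandermonde // mulrC; congr (_ * _).
rewrite (big_nth 0) big_mkord -ds; apply: eq_bigr => j _; by rewrite mxE.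
Qed.

(** The roots are simple: the derivative [m X^(m-1)] vanishes at most at 0, which is not a root. *)
Lemma XnsubC_split (C : numClosedFieldType) (m : nat) (z : C) :
  (0 < m)%N -> z != 0 ->
  exists2 s : seq C, uniq s & 'X^m - z%:P = \prod_(x <- s) ('X - x%:P).
Proof.
move=> m_gt0 zn0; have [s sE] := closed_field_poly_normal ('X^m - z%:P).
rewrite (monicP (monicXnsubC z m_gt0)) scale1r in sE; exists s => //.
rewrite -separable_prod_XsubC -sE separable_poly.unlock derivB derivC subr0 derivXn.
apply: Pdiv.ClosedField.root_coprimep => x.
rewrite rootE !hornerE subr_eq0 => /eqP xm.
rewrite hornerMn hornerXn mulrn_eq0 gtn_eqF //.
by apply: contraNneq zn0 => x0; rewrite -xm -(prednK m_gt0) exprS x0 mulr0.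
Qed.

(** A Bezout relation [u m + v k = 1] recovers [x] from [x^m] and [x^k]. *)
Lemma coprime_expr_inj (F : fieldType) (m k : int) (x y : F) :
  coprimez m k -> x != 0 -> y != 0 -> x ^ m = y ^ m -> x ^ k = y ^ k -> x = y.
Proof.
move=> /coprimezP[[u v] /= uv1] xn0 yn0 xym xyk.
rewrite -[x]expr1z -[y]expr1z -uv1 !expfzDr // ![u * m]mulrC ![v * k]mulrC.
by rewrite -!exprz_exp xym xyk.
Qed.

(** By coprimality [x |-> x^k] maps the roots of [X^m - z] bijectively onto those of [X^m - z^k], so
    the product is the homogenised polynomial [X^m - z^k] at [(a, b)]. *)
Lemma prod_sub_roots (F : fieldType) (m : nat) (k : int) (z a b : F) (s : seq F) :
  (0 < m)%N -> coprimez m%:Z k -> z != 0 -> uniq s ->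
  'X^m - z%:P = \prod_(x <- s) ('X - x%:P) ->
  \prod_(x <- s) (a - b * x ^ k) = a ^+ m - b ^+ m * z ^ k.
Proof.
move=> m_gt0 mk zn0 s_uniq sE.
have sm : size s = m.
  by apply: succn_inj; rewrite -(size_prod_XsubC s id) -sE size_XnsubC.
have xm x : x \in s -> x ^+ m = z.
  by rewrite -root_prod_XsubC -sE rootE !hornerE subr_eq0 => /eqP.
have xn0 x : x \in s -> x != 0.
  by move=> /xm xz; apply: contraNneq zn0 => x0; rewrite -xz x0 expr0n gtn_eqF.
have prodX : 'X^m - (z ^ k)%:P = \prod_(x <- s) ('X - (x ^ k)%:P).
  rewrite -(big_map (fun x => x ^ k) predT (fun y => 'X - y%:P)).
  rewrite [LHS](@all_roots_prod_XsubC _ _ [seq x ^ k | x <- s]).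
  - by rewrite (monicP (monicXnsubC _ m_gt0)) scale1r.
  - by rewrite size_XnsubC // size_map sm.
  - apply/allP => _ /mapP[x xs ->]; rewrite rootE !hornerE.
    by rewrite exprnP exprzAC -exprnP xm // subrr.
  - rewrite uniq_rootsE map_inj_in_uniq // => x y xs ys.
    by apply: coprime_expr_inj mk (xn0 _ xs) (xn0 _ ys) _; rewrite -!exprnP !xm.
have const c : \prod_(x <- s) c = c ^+ m.
  by rewrite big_const_seq count_predT sm iter_mulr_1.
have [->|bn0] := eqVneq b 0.
  rewrite expr0n gtn_eqF // mul0r subr0 -const.
  by apply: eq_bigr => x _; rewrite mul0r subr0.
(* Homogenising means evaluating at [a / b] and multiplying by [b^m], which is why [b = 0] is
   treated apart. *)
have /(congr1 (fun p => b ^+ m * p.[a / b])) := prodX.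
rewrite horner_prod !hornerE mulrBr -exprMn (mulrC b) divfK // => ->.
rewrite -const.
rewrite -big_split /=; apply: eq_bigr => x _.
by rewrite !hornerE mulrBr [b * (a / b)]mulrC divfK.
Qed.

(** The list [s] collects the fibres of [x |-> x^m] over [r]. As [a] and [b] are applied to [x^m],
    they are constant on each fibre, where [prod_sub_roots] applies. *)
Lemma roots_comp_Xn (C : numClosedFieldType) (m : nat) (k : int) (r : seq C) :
  (0 < m)%N -> coprimez m%:Z k -> uniq r -> 0 \notin r ->
  exists s : seq C,
    [/\ uniq s, forall x, (x \in s) = (x ^+ m \in r),
        \prod_(x <- s) ('X - x%:P) = \prod_(z <- r) ('X^m - z%:P)
      & forall a b : C -> C, \prod_(x <- s) (a (x ^+ m) - b (x ^+ m) * x ^ k) =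
          \prod_(z <- r) (a z ^+ m - b z ^+ m * z ^ k)].
Proof.
move=> m_gt0 mk; elim: r => [|z r IH] /=.
  by exists [::]; split=> // [|a b]; rewrite !big_nil.
case/andP=> zr r_uniq; rewrite inE negb_or eq_sym => /andP[zn0 r0].
have [s [s_uniq sE sX sP]] := IH r_uniq r0.
have [t t_uniq tX] := XnsubC_split m_gt0 zn0.
have tE x : (x \in t) = (x ^+ m == z).
  by rewrite -root_prod_XsubC -tX rootE !hornerE subr_eq0.
exists (t ++ s); split.
- rewrite cat_uniq t_uniq s_uniq andbT; apply/hasPn => x.
  by rewrite sE tE; apply: contraTneq => ->.
- by move=> x; rewrite mem_cat tE sE inE.
- by rewrite big_cat big_cons sX tX.
- move=> a b; rewrite big_cat big_cons sP; congr (_ * _).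
  rewrite -(prod_sub_roots (a z) (b z) m_gt0 mk zn0 t_uniq tX).
  by apply: eq_big_seq => x; rewrite tE => /eqP ->.
Qed.

(** Leading coefficients with nonzero image keep both sizes, so the Sylvester matrix is mapped
    entrywise. *)
Lemma resultant_map (aR rR : nzRingType) (h : {rmorphism aR -> rR})
    (p q : {poly aR}) :
  h (lead_coef p) != 0 -> h (lead_coef q) != 0 ->
  resultant (map_poly h p) (map_poly h q) = h (resultant p q).
Proof.
move=> hp hq; rewrite /resultant -det_map_mx /Sylvester_mx !size_map_poly_id0 //.
congr (\det _); apply/matrixP=> i j; rewrite !mxE.
case: split_ordP => k _; rewrite !mxE /=.
  by rewrite !rVpoly_delta !coefXnM; case: ifP => _; rewrite ?rmorph0 ?coef_map.
by rewrite !rVpoly_delta !coefXnM; case: ifP => _; rewrite ?rmorph0 ?coef_map.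
Qed.

Lemma normr_resultant (C : numClosedFieldType) (f g : {poly int}) (s : seq C) :
  f != 0 -> g \is monic -> uniq s ->
  map_poly intr g = \prod_(x <- s) ('X - x%:P) ->
  `|resultant f g|%:~R = \prod_(x <- s) `|(map_poly intr f).[x]|.
Proof.
move=> fn0 gmon s_uniq gE; rewrite -normr_prod -resultant_prod_roots // -gE.
rewrite resultant_map ?intr_eq0 ?lead_coef_eq0 ?(monic_neq0 gmon) //.
by rewrite intr_norm.
Qed.

(** * Closed forms *)

Section Cis.
Context {R : realType}.
Implicit Types x y a b : R.

Definition cis x : R[i] := cos x +i* sin x.

Lemma cisD x y : cis (x + y) = cis x * cis y.
Proof. by rewrite /cis cosD sinD; simpc; congr (_ +i* _); ring. Qed.

Lemma cis0 : cis 0 = 1. Proof. by rewrite /cis cos0 sin0. Qed.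

Lemma cisN x : cis (- x) = (cis x)^-1.
Proof.
by apply/esym/mulr1_eq; rewrite -cisD subrr cis0.
Qed.

Lemma cisX x (n : nat) : cis x ^+ n = cis (n%:R * x).
Proof.
elim: n => [|n IH]; first by rewrite mul0r cis0.
by rewrite exprS IH -cisD !mulr_natl mulrS.
Qed.

Lemma cisXz x (n : int) : cis x ^ n = cis (n%:~R * x).
Proof.
case: n => n; first exact: cisX.
by rewrite NegzE -exprz_inv -cisN -exprnP cisX intrN mulNr mulrN.
Qed.

(** The law of cosines, with angle [x - y]. *)
Lemma sqr_norm_sub_cis a b x y :
  `|a%:C * cis x - b%:C * cis y| ^+ 2 =
    (a ^+ 2 + b ^+ 2 - 2 * (a * b) * cos (x - y))%:C.
Proof.
rewrite -add_Re2_Im2 /cis cosB /=; simpc => /=; congr (_ +i* _).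
have := cos2Dsin2 x; have := cos2Dsin2 y; nra.
Qed.

Lemma cos_sin_pi6 : cos (pi / 6) = Num.sqrt 3 / 2 :> R /\ sin (pi / 6) = 1 / 2 :> R.
Proof.
have pi0 : 0 < pi :> R := pi_gt0 R.
set t := pi / 6 : R.
have c0 : 0 < cos t by apply: cos_gt0_pihalf; rewrite /t; lra.
have s0 : 0 < sin t by apply: sin_gt0_pihalf; rewrite /t; lra.
(* As [3 t] is a right angle, the triple angle formula gives [cos t (4 cos^2 t - 3) = 0]. *)
have c3 : cos (t + (t + t)) = 0.
  have -> : t + (t + t) = pi / 2 by rewrite /t; field.
  exact: cos_pihalf.
have cs := cos2Dsin2 t.
have c2 : cos t ^+ 2 = 3 / 4.
  move: c3; rewrite cosD cosD sinD.
  nra.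
have s2 : sin t ^+ 2 = (1 / 2) ^+ 2 by nra.
have q3 : 0 <= 3 :> R by lra.
split; last by apply/eqP; rewrite -(@eqrXn2 _ 2) ?s2 //; lra.
apply/eqP; rewrite -(@eqrXn2 _ 2) ?(ltW c0) ?divr_ge0 ?sqrtr_ge0 //.
by rewrite expr_div_n sqr_sqrtr // c2; apply/eqP; field.
Qed.

Lemma cos_sin_pi4 : cos (pi / 4) = Num.sqrt 2 / 2 :> R /\ sin (pi / 4) = Num.sqrt 2 / 2 :> R.
Proof.
have pi0 : 0 < pi :> R := pi_gt0 R.
set t := pi / 4 : R.
have c0 : 0 < cos t by apply: cos_gt0_pihalf; rewrite /t; lra.
have s0 : 0 < sin t by apply: sin_gt0_pihalf; rewrite /t; lra.
have c2t : cos (t + t) = 0.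
  have -> : t + t = pi / 2 by rewrite /t; field.
  exact: cos_pihalf.
have cs := cos2Dsin2 t; rewrite cosD in c2t.
have q2 : 0 <= 2 :> R by lra.
have h2 : (Num.sqrt 2 / 2) ^+ 2 = 1 / 2 :> R.
  by rewrite expr_div_n sqr_sqrtr //; field.
have q0 : 0 <= Num.sqrt 2 / 2 :> R by rewrite divr_ge0 ?sqrtr_ge0.
by split; apply/eqP; rewrite -(@eqrXn2 _ 2) ?(ltW c0) ?(ltW s0) // h2; apply/eqP; nra.
Qed.

Lemma cis_pi2 : cis (pi / 2) = 'i%C.
Proof. by rewrite /cis cos_pihalf sin_pihalf. Qed.

(** Polar form of [1 + zeta] at [zeta = i], the value of [a] when [n = 4]. *)
Lemma cis_pi4 : (Num.sqrt 2)%:C * cis (pi / 4) = 1 + 'i%C.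
Proof.
have [c s] := cos_sin_pi4; have /(congr1 (fun x : R => x / 2)) := sqr_sqrtr (ler0n R 2).
rewrite divff ?pnatr_eq0 // expr2 -mulrA => h.
by rewrite /cis c s; simpc; rewrite h.
Qed.

Lemma cis_pi3 : cis (pi / 3) = (1 / 2) +i* (Num.sqrt 3 / 2).
Proof.
have [c s] := cos_sin_pi6.
have -> : pi / 3 = pi / 6 + pi / 6 :> R by field.
have q3 := sqr_sqrtr (ler0n R 3); rewrite cisD /cis c s.
by simpc; congr (_ +i* _); nra.
Qed.

(** Polar form of [1 + zeta] at [zeta = cis (pi / 3)], the value of [b] when [n = 6]. *)
Lemma cis_pi6 : (Num.sqrt 3)%:C * cis (pi / 6) = 1 + cis (pi / 3).
Proof.
have [c s] := cos_sin_pi6; rewrite cis_pi3 /cis c s.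
have q3 := sqr_sqrtr (ler0n R 3).
by simpc; congr (_ +i* _); nra.
Qed.
End Cis.

(** Polynomials need a natural exponent [k']; at an [N]-th root of unity it gives the same power as
    the integer [k]. *)
Lemma expr_eq_mod (F : fieldType) (N k' : nat) (k : int) (x : F) :
  (0 < N)%N -> x ^+ N = 1 -> (k'%:Z = k %[mod N%:Z])%Z -> x ^+ k' = x ^ k.
Proof.
move=> N_gt0 xN /eqP; rewrite eqz_mod_dvd => /dvdzP[q /eqP].
rewrite subr_eq addrC => /eqP k'E.
have xn0 : x != 0.
  by apply: contra_eq_neq xN => ->; rewrite expr0n gtn_eqF // eq_sym oner_eq0.
by rewrite exprnP k'E expfzDr // [q * _]mulrC -exprz_exp -exprnP xN exp1rz mulr1.
Qed.

(** Here [r] lists the values [zeta = x^m] at the roots [x] of [g]. It has only two or three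
    elements in the applications, which makes the second product explicit. *)
Lemma resultant_roots_Xn (R : realType) (m : nat) (k : int) (f g : {poly int})
    (r : seq R[i]) (a b : R[i] -> R[i]) :
  (0 < m)%N -> coprimez m%:Z k -> f != 0 -> g \is monic -> uniq r -> 0 \notin r ->
  map_poly intr g = \prod_(z <- r) ('X^m - z%:P) ->
  (forall x, x ^+ m \in r ->
    (map_poly intr f).[x] = a (x ^+ m) - b (x ^+ m) * x ^ k) ->
  `|resultant f g|%:~R =
     \big[*%R/1]_(x \in [set x : R[i] | x ^+ m \in r])
        `|a (x ^+ m) - b (x ^+ m) * x ^ k| /\
  `|resultant f g|%:~R = \prod_(z <- r) `|a z ^+ m - b z ^+ m * z ^ k|.
Proof.
move=> m_gt0 mk fn0 gmon r_uniq r0 gE fE.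
have [s [s_uniq sE sX sP]] := roots_comp_Xn m_gt0 mk r_uniq r0.
rewrite (normr_resultant fn0 gmon s_uniq) ?gE ?sX //.
have -> : \prod_(x <- s) `|(map_poly intr f).[x]| =
          \prod_(x <- s) `|a (x ^+ m) - b (x ^+ m) * x ^ k|.
  by apply: eq_big_seq => x; rewrite sE => /fE ->.
split; last by rewrite -!normr_prod sP.
have -> : [set x : R[i] | x ^+ m \in r] = [set` s].
  by apply/seteqP; split=> x /=; rewrite sE.
by rewrite -fsbig_seq.
Qed.

Lemma normr_conjc (R : realType) (z : R[i]) : `|z^*| = `|z|.
Proof. by rewrite !normc_def; case: z => x y /=; rewrite sqrrN. Qed.

Lemma conjc_expz (R : realType) (z : R[i]) (k : int) : (z ^ k)^* = z^* ^ k.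
Proof. exact: fmorphXz. Qed.

(** * The two resultants in closed form *)

Section Values.
Context {R : realType} (m : nat) (k : int).
Hypotheses (m_gt0 : (0 < m)%N) (mk : coprimez m%:Z k).

Lemma resultant4 (k' : nat) : (k'%:Z = k %[mod (4 * m)%N%:Z])%Z ->
  let a : int := `|resultant (1 + 'X^m - 'X^k' : {poly int}) (1 + 'X^(2 * m))| in
  a%:~R = \big[*%R/1]_(l \in [set l : R[i] | l ^+ (2 * m) = -1])
            `|1 + l ^+ m - l ^ k| /\
  a%:~R = 2 ^+ m + 1 - 2 * Num.sqrt 2 ^+ m * cos ((2 * k - m%:Z)%:~R * pi / 4) :> R.
Proof.
move=> k'E a; pose r : seq R[i] := [:: 'i%C; - 'i%C].
have rE (z : R[i]) : (z \in r) = (z ^+ 2 == -1).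
  by rewrite !inE -[RHS]subr_eq0 -[X in _ - X](@sqr_i R) subr_sqr mulf_eq0 subr_eq0 addr_eq0.
(* Its value at 1 is 1, whatever the exponents. *)
have fn0 : 1 + 'X^m - 'X^k' != 0 :> {poly int}.
  by apply/eqP => /(congr1 (fun p => p.[1])); rewrite !hornerE !expr1n.
have gmon : 1 + 'X^(2 * m) \is @monic int.
  by rewrite addrC monicXnaddC // muln_gt0.
have xN (x : R[i]) : x ^+ m \in r -> x ^+ (4 * m) = 1.
  rewrite rE -exprM => /eqP xm; have -> : (4 * m = m * 2 * 2)%N by lia.
  by rewrite exprM xm sqrrN expr1n.
have i0 : 'i%C != 0 :> R[i] by rewrite eq_complex /= oner_eq0 andbF.
have [||||E1 E2] := @resultant_roots_Xn R m k _ _ r (fun z => 1 + z) (fun=> 1)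
  m_gt0 mk fn0 gmon.
- by rewrite /= inE andbT -subr_eq0 opprK -mulr2n mulrn_eq0.
- by rewrite !inE eq_sym (negPf i0) eq_sym oppr_eq0.
- rewrite !big_cons big_nil mulr1 rmorphD rmorph1 /= map_polyXn mulnC exprM.
  rewrite polyCN; set u := 'X^m; set w := _%:P.
  have w2 : w ^+ 2 = -1 by rewrite -rmorphXn /= sqr_i polyCN.
  by transitivity (u ^+ 2 - w ^+ 2); [rewrite w2; ring | ring].
- move=> x /xN x4; rewrite rmorphB rmorphD rmorph1 /= !map_polyXn !hornerE.
  by congr (_ - _); apply: expr_eq_mod x4 k'E; rewrite muln_gt0.
split.
  rewrite E1; have -> : [set x : R[i] | x ^+ m \in r] = [set l | l ^+ (2 * m) = -1].
    by apply/seteqP; split=> x /=; rewrite rE -exprM mulnC => /eqP.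
  by apply: eq_fsbigr => x _; rewrite mul1r.
have bE (z : R[i]) : (1 + z) ^+ m - 1 ^+ m * z ^ k = (1 + z) ^+ m - z ^ k.
  by rewrite expr1n mul1r.
apply: complexI; rewrite rmorph_int E2 big_cons big_seq1 (bE 'i%C) (bE (- 'i%C)).
(* The factors at [i] and [-i] are complex conjugates, so the product of their moduli is [|w|^2]. *)
set w := (1 + 'i%C) ^+ m - 'i%C ^ k.
have -> : (1 - 'i%C) ^+ m - (- 'i%C) ^ k = w^*.
  have conj_i : 'i%C^* = - 'i%C :> R[i] by simpc.
  by rewrite /w rmorphB /= conjc_expz rmorphXn /= rmorphD rmorph1 /= conj_i.
rewrite normr_conjc -expr2.
have -> : w = (Num.sqrt 2 ^+ m)%:C * cis (m%:R * (pi / 4)) - 1%:C * cis (k%:~R * (pi / 2)).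
  by rewrite mul1r rmorphXn -cisX -cisXz -exprMn cis_pi4 cis_pi2.
rewrite sqr_norm_sub_cis -exprM mulnC exprM sqr_sqrtr ?ler0n // expr1n mulr1.
congr (_ - _ * _)%:C; rewrite -cosN; congr cos.
by rewrite rmorphB rmorphM /=; field.
Qed.

Lemma resultant6 (k' : nat) : (k'%:Z = k %[mod (6 * m)%N%:Z])%Z ->
  let a : int := `|resultant (1 + 'X^m + 'X^(2 * m) - 'X^k' - 'X^(m + k') : {poly int})
                     (1 + 'X^(3 * m))| in
  a%:~R = \big[*%R/1]_(l \in [set l : R[i] | l ^+ (3 * m) = -1])
             `|1 + l ^+ m + l ^+ (2 * m) - l ^ k * (1 + l ^+ m)| /\
  a%:~R = 3 ^+ m + 4 ^+ m - 2 * (2 * Num.sqrt 3) ^+ m *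
            cos ((2 * k - m%:Z)%:~R * pi / 6) :> R.
Proof.
move=> k'E a; pose w : R[i] := cis (pi / 3); pose r : seq R[i] := [:: -1; w; w^*].
have [wD wM] : w + w^* = 1 /\ w * w^* = 1.
  rewrite /w cis_pi3; have q3 := sqr_sqrtr (ler0n R 3).
  by split; simpc; congr (_ +i* _); nra.
have w2 : w ^+ 2 = w - 1 by rewrite -wM -{2}[w]mulr1 -wD; ring.
(* The ring is arbitrary because the factorisation serves for complex numbers in [rE] and for
   polynomials in the splitting of [g]. *)
have polyE (S : comNzRingType) (u v v' : S) : v + v' = 1 -> v * v' = 1 ->
    (u + 1) * ((u - v) * (u - v')) = 1 + u ^+ 3.
  move=> vD vM; transitivity ((u + 1) * (u ^+ 2 - (v + v') * u + v * v')); first ring.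
  by rewrite vD vM; ring.
have rE (z : R[i]) : (z \in r) = (z ^+ 3 == -1).
  rewrite !inE -[RHS]subr_eq0 opprK addrC -(polyE _ z _ _ wD wM) !mulf_eq0.
  by rewrite !subr_eq0 addr_eq0.
have fn0 : 1 + 'X^m + 'X^(2 * m) - 'X^k' - 'X^(m + k') != 0 :> {poly int}.
  by apply/eqP => /(congr1 (fun p => p.[1])); rewrite !hornerE !expr1n.
have gmon : 1 + 'X^(3 * m) \is @monic int.
  by rewrite addrC monicXnaddC // muln_gt0.
have xN (x : R[i]) : x ^+ m \in r -> x ^+ (6 * m) = 1.
  rewrite rE -exprM => /eqP xm; have -> : (6 * m = m * 3 * 2)%N by lia.
  by rewrite exprM xm sqrrN expr1n.
have ww' : w != w^*.
  rewrite /w cis_pi3 eq_complex /= eqxx /= -subr_eq0 opprK -splitr.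
  by rewrite sqrtr_eq0 -ltNge.
have wn1 : w != -1.
  apply: contraTneq isT => w1; move/eqP: w2; rewrite w1 -subr_eq0.
  have -> : (-1) ^+ 2 - (-1 - 1) = 3 :> R[i] by ring.
  by rewrite pnatr_eq0.
have w'n1 : w^* != -1.
  apply: contraNneq wn1 => w1; have := congr1 (@conjc R) w1.
  by rewrite conjcK => ->; rewrite rmorphN rmorph1.
have wn0 : w != 0 by apply: contra_eq_neq wM => ->; rewrite mul0r eq_sym oner_eq0.
have w'n0 : w^* != 0 by rewrite conjc_eq0.
have [||||E1 E2] := @resultant_roots_Xn R m k _ _ r (fun z => 1 + z + z ^+ 2)
  (fun z => 1 + z) m_gt0 mk fn0 gmon.
- by rewrite /= !inE negb_or ww' ![-1 == _]eq_sym wn1 w'n1.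
- by rewrite !inE ![0 == _]eq_sym (negPf wn0) (negPf w'n0) oppr_eq0 oner_eq0.
- rewrite !big_cons big_nil mulr1 rmorphD rmorph1 /= map_polyXn mulnC exprM.
  by rewrite polyCN opprK polyE // -?rmorphD -?rmorphM /= ?wD ?wM.
- move=> x /xN x6; rewrite !(rmorphB, rmorphD, rmorph1) /= !map_polyXn !hornerE.
  rewrite -(expr_eq_mod _ x6 k'E).
    by rewrite mulnC exprM exprD; ring.
  by rewrite muln_gt0.
split.
  rewrite E1; have -> : [set x : R[i] | x ^+ m \in r] = [set l | l ^+ (3 * m) = -1].
    by apply/seteqP; split=> x /=; rewrite rE -exprM mulnC => /eqP.
  by apply: eq_fsbigr => x _; rewrite mulnC exprM [X in _ - X]mulrC.
apply: complexI; rewrite rmorph_int E2 2!big_cons big_seq1.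
(* At [zeta = -1] one has [b = 1 + zeta = 0] and [a = 1], so this factor is 1. *)
rewrite subrr add0r sqrrN !expr1n expr0n gtn_eqF // mul0r subr0 normr1 mul1r.
set v := (1 + w + w ^+ 2) ^+ m - (1 + w) ^+ m * w ^ k.
have -> : (1 + w^* + w^* ^+ 2) ^+ m - (1 + w^*) ^+ m * w^* ^ k = v^*.
  rewrite /v rmorphB rmorphM /= conjc_expz !rmorphXn /= !rmorphD rmorph1 /=.
  by rewrite rmorphXn.
rewrite normr_conjc -expr2.
(* From [w^2 = w - 1] one gets [1 + w + w^2 = 2 w], and [1 + w] is given by [cis_pi6]. *)
have -> : v = (2 ^+ m)%:C * cis (m%:R * (pi / 3)) -
              (Num.sqrt 3 ^+ m)%:C * cis (m%:R * (pi / 6) + k%:~R * (pi / 3)).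
  rewrite !rmorphXn cisD [X in _ - X]mulrA -!cisX -cisXz -!exprMn cis_pi6 -/w rmorph_nat.
  by congr (_ ^+ m - _); rewrite w2; ring.
have sq (x : R) : (x ^+ m) ^+ 2 = (x ^+ 2) ^+ m by rewrite -!exprM mulnC.
rewrite sqr_norm_sub_cis !sq sqr_sqrtr ?ler0n // -exprMn.
have -> : 2 ^+ 2 = 4 :> R by ring.
rewrite [4 ^+ m + _]addrC.
congr (_ - _ * _)%:C; rewrite -cosN; congr cos.
by rewrite rmorphB rmorphM /=; field.
Qed.
End Values.

(** * Subgroups and quotients of presented groups *)

Local Open Scope group_scope.

Section Subgroups.
Variable G : groupType.
Implicit Types (H K : set G) (x y g : G).

Definition is_normal H := forall x g, H x -> H (x ^ g).

Lemma derived_subgroup H : is_subgroup (derived H).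
Proof.
split=> [K [[]] //|x y Hx Hy K KP|x Hx K KP].
  by case: (KP) => -[_ KM _] _; apply: KM; [apply: Hx|apply: Hy].
by case: (KP) => -[_ _ KV] _; apply: KV; apply: Hx.
Qed.

Lemma derivedR H x y : H x -> H y -> derived H [~ x, y].
Proof. by move=> Hx Hy; apply: sub_gen_smallest; exists x, y. Qed.

Lemma derived_ind H K : is_subgroup K ->
  (forall x y, H x -> H y -> K [~ x, y]) -> derived H `<=` K.
Proof. by move=> Ksub KR; apply: smallest_sub => // _ [x [y [Hx Hy ->]]]; apply: KR. Qed.

Lemma derived_normal H : is_normal H -> is_normal (derived H).
Proof.
move=> Hn x g; have [D1 DM DV] := derived_subgroup H.
suff /(_ x) : derived H `<=` [set x | derived H (x ^ g)] by apply.
apply: derived_ind => [|y z Hy Hz] /=; last by rewrite conjRg; apply: derivedR; apply: Hn.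
split=> [|y z|y] /=; first by rewrite conj1g.
  by rewrite conjMg; apply: DM.
by rewrite conjVg; apply: DV.
Qed.

(** The function [f] separates the cosets and takes exactly the values below [n], so choosing a
    representative for each value enumerates the cosets without repetition. *)
Lemma card_lcosets (A H : set G) (f : G -> nat) (n : nat) :
  (forall x y, A x -> A y -> f x = f y <-> H (x^-1 * y)) -> is_subgroup H ->
  (forall x, A x -> (f x < n)%N) -> (forall i, (i < n)%N -> exists2 x, A x & f x = i) ->
  lcosets A H #= `I_n.
Proof.
move=> fE [H1 HM HV] f_lt f_surj.
have cosetE x y : [set x * h | h in H] = [set y * h | h in H] <-> H (x^-1 * y).
  split=> [xy|Hxy].
    have [h Hh <-] : [set x * h | h in H] y by rewrite xy; exists 1; rewrite ?mulg1.
    by rewrite mulKg.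
  apply/seteqP; split=> _ [h Hh <-].
    exists (y^-1 * x * h); first by apply: HM => //; rewrite -[x]invgK -invgM; apply: HV.
    by rewrite -!mulgA mulVKg.
  by exists (x^-1 * y * h); [apply: HM|rewrite -!mulgA mulVKg].
pose rep (i : nat) := if pselect (i < n)%N is left lt then sval (cid2 (f_surj i lt)) else 1.
have repP i : (i < n)%N -> A (rep i) /\ f (rep i) = i.
  rewrite /rep; case: pselect => // lt _; case: cid2 => x /= Ax fx.
  by split.
have -> : lcosets A H = (fun i => [set rep i * h | h in H]) @` `I_n.
  apply/seteqP; split=> [_ [x Ax <-]|_ [i /repP[Ai _] <-]]; last by exists (rep i).
  exists (f x); first exact: f_lt.
  by have [Ar fr] := repP _ (f_lt _ Ax); apply/cosetE/fE.
apply: inj_card_eq => i j /set_mem/repP[Ai fi] /set_mem/repP[Aj fj] /cosetE/(fE _ _ Ai Aj).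
by rewrite fi fj.
Qed.
End Subgroups.

Section Words.
Variables (G : groupType) (X : Type).

Lemma word_eval_cat (f : X -> G) u v :
  word_eval f (u ++ v) = word_eval f u * word_eval f v.
Proof. by rewrite /word_eval big_cat. Qed.

Lemma word_eval_nil (f : X -> G) : word_eval f [::] = 1.
Proof. by rewrite /word_eval big_nil. Qed.

Lemma word_eval_cons (f : X -> G) x b u :
  word_eval f ((x, b) :: u) = (if b then (f x)^-1 else f x) * word_eval f u.
Proof. by rewrite /word_eval big_cons. Qed.

Lemma morph_word_eval (K : groupType) (h : G -> K) (f : X -> G) u :
  {morph h : x y / x * y} -> h (word_eval f u) = word_eval (h \o f) u.
Proof.
move=> hM; have h1 : h 1 = 1 by apply: (mulgI (h 1)); rewrite -hM !mulg1.
have hV x : h x^-1 = (h x)^-1 by apply: (mulgI (h x)); rewrite -hM !mulgV.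
rewrite /word_eval (big_morph h hM h1); apply: eq_bigr => -[x []] _ //=.
Qed.
End Words.

(** * Quotient by a normal subgroup *)

Section Quotient.
Variables (G : groupType) (N : set G).
Hypotheses (Nsub : is_subgroup N) (Nnormal : is_normal N).

(** [G / N] becomes a group type by presenting it with all elements of [G] as generators and all
    words with value in [N] as relators. *)
Definition quot_rels : set (word G) := [set w | N (word_eval id w)].

Definition quot_pi (x : G) : presented quot_rels := pres_gen quot_rels x.

Lemma quot_piM : {morph quot_pi : x y / x * y}.
Proof.
move=> x y; apply/esym/divg1_eq.
have /pres_gen_rel : quot_rels [:: (x, false); (y, false); (x * y, true)].
  by rewrite /quot_rels /= !word_eval_cons word_eval_nil mulg1 mulgA mulgV; case: Nsub.
by rewrite !word_eval_cons word_eval_nil mulg1 mulgA.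
Qed.

Lemma quot_pi_eq1 x : quot_pi x = 1 <-> N x.
Proof.
have [N1 NM NV] := Nsub; split=> [|Nx]; last first.
  have /pres_gen_rel : quot_rels [:: (x, false)].
    by rewrite /quot_rels /= word_eval_cons word_eval_nil mulg1.
  by rewrite word_eval_cons word_eval_nil mulg1.
move=> /pres_piP xE.
(* The value of a word stays in one left coset of [N] along elementary moves; normality carries an
   inserted relator past the word on its right. *)
suff /(_ _ _ xE) : forall u v, pres_eq quot_rels u v ->
    N ((word_eval id u)^-1 * word_eval id v).
  by rewrite word_eval_cons word_eval_nil !mulg1 => /NV; rewrite invgK.
move=> u v; elim=> {u v} [w|v w _|u v w _ Nuv _ Nvw|u [y b] v|u r v Nr].
- by rewrite mulVg.
- by move/NV; rewrite invgM invgK.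
- by rewrite -(mulgK (word_eval id v) (_^-1)) -mulgA; apply: NM.
- rewrite !word_eval_cat !word_eval_cons word_eval_nil /=.
  by case: b; rewrite /= mulg1 (mulVg, mulgV) mul1g mulVg.
- rewrite !word_eval_cat !invgM -!mulgA mulKg.
  exact: Nnormal (word_eval id v) (NV _ Nr).
Qed.

Lemma quot_pi_surj q : exists x, q = quot_pi x.
Proof.
exists (word_eval id (pres_repr q)).
by rewrite (morph_word_eval _ _ quot_piM) word_eval_gen pres_reprK.
Qed.
End Quotient.

Section IntPowers.
Variable G : groupType.
Implicit Types (x y : G) (a b : int).

Definition expgz x a : G :=
  match a with Posz n => x ^+ n | Negz n => x ^- n.+1 end.

Lemma expgz_succ x a : expgz x (1 + a)%R = x * expgz x a.
Proof.
case: a => [n|[|n]] /=; first exact: expgS.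
  by rewrite mulgV.
by rewrite [x ^+ n.+2]expgSr invgM mulVKg subn1.
Qed.

Lemma expgzD x a b : expgz x (a + b)%R = expgz x a * expgz x b.
Proof.
elim/int_rect: a => [|n IH|n IH]; first by rewrite add0r mul1g.
  by rewrite -[n.+1]add1n PoszD -addrA !expgz_succ IH mulgA.
apply: (mulgI x); rewrite mulgA -!expgz_succ addrA.
suff -> : (1 + - n.+1%:Z = - n%:Z)%R by [].
by rewrite -[n.+1]addn1 PoszD; ring.
Qed.

Lemma expgzN x a : expgz x (- a)%R = (expgz x a)^-1.
Proof. by apply/esym/mulg1_eq; rewrite -expgzD subrr. Qed.

Lemma expgVz x a : expgz x^-1 a = (expgz x a)^-1.
Proof. by case: a => n /=; rewrite expVgn. Qed.

Lemma subgroup_expgz (H : set G) x a : is_subgroup H -> H x -> H (expgz x a).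
Proof.
move=> [H1 HM HV] Hx; have HX n : H (x ^+ n).
  by elim: n => // n IH; rewrite expgS; apply: HM.
by case: a => n; [apply: HX|apply/HV/HX].
Qed.

Lemma word_eval_expz (X : Type) (f : X -> G) (x : X) a :
  word_eval f (word_expz x a) = expgz (f x) a.
Proof.
have nseqE (b : bool) n : word_eval f (nseq n (x, b)) = (if b then (f x)^-1 else f x) ^+ n.
  by elim: n => [|n IH]; rewrite ?word_eval_nil //= word_eval_cons IH expgS.
by case: a => n; rewrite /word_expz nseqE //= expVgn.
Qed.
End IntPowers.

Definition poly_ideal (K : {poly int} -> Prop) :=
  [/\ K 0%R, forall p q, K p -> K q -> K (p + q)%R & forall p q, K q -> K (p * q)%R].

(** The polynomial [p] is built by Horner steps [p X + c], and the integer [c] is reached by adding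
    or subtracting 1 repeatedly, so stability under [X], sums and opposites suffices. *)
Lemma polyX_closed (K : {poly int} -> Prop) (q : {poly int}) :
  K 0%R -> (forall p r, K p -> K r -> K (p + r)%R) ->
  (forall p, K p -> K (- p)%R) -> (forall p, K p -> K ('X * p)%R) ->
  K q -> forall p, K (p * q)%R.
Proof.
move=> K0 KD KN KX Kq; elim/poly_ind => [|p c IH]; first by rewrite mul0r.
rewrite mulrDl; apply: (KD); first by rewrite mulrAC mulrC; apply: KX.
rewrite mul_polyC; elim/int_rect: c => [|n IHn|n IHn]; first by rewrite scale0r.
  by rewrite -[n.+1]add1n PoszD scalerDl scale1r; apply: KD.
rewrite -[n.+1]add1n PoszD opprD scalerDl scaleN1r.
by apply: KD => //; apply: KN.
Qed.

(** * Action of Z[x] on an abelian normal subgroup *)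

Section ConjugatePolynomials.
Variables (G : groupType) (B : set G) (tau z : G).
Hypotheses (Bsub : is_subgroup B) (Bn : is_normal B) (Btau : B tau).
Hypothesis BC : forall x y, B x -> B y -> commute x y.

(* Horner scheme for [tau ^ p], the product of the [z^i tau^(p_i) z^-i]. *)
Definition conj_poly (p : {poly int}) : G :=
  foldr (fun c h => expgz tau c * h ^ z^-1) 1 p.

Local Notation e := conj_poly.

Lemma conj_poly_cons p c : e (p * 'X + c%:P)%R = expgz tau c * e p ^ z^-1.
Proof.
rewrite -cons_poly_def /e polyseq_cons; case: ifP => // /negbFE/nilP p0.
rewrite p0 /= polyseqC; have [->|_] := eqVneq c 0%R; last by [].
by rewrite /= conj1g mulg1.
Qed.

Lemma conj_poly0 : e 0 = 1. Proof. by rewrite /e polyseq0. Qed.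

Lemma conj_poly_in p : B (e p).
Proof.
have [B1 BM BV] := Bsub; elim/poly_ind: p => [|p c IH]; first by rewrite conj_poly0.
by rewrite conj_poly_cons; apply: BM; [apply: subgroup_expgz|apply: Bn].
Qed.

Lemma conj_polyD p q : e (p + q)%R = e p * e q.
Proof.
elim/poly_ind: p q => [|p c IH] q; first by rewrite add0r conj_poly0 mul1g.
elim/poly_ind: q => [|q d _]; first by rewrite addr0 conj_poly0 mulg1.
have -> : (p * 'X + c%:P + (q * 'X + d%:P) = (p + q) * 'X + (c + d)%:P)%R.
  by rewrite polyCD; ring.
rewrite !conj_poly_cons IH conjMg expgzD.
have : B (e p ^ z^-1) by apply: Bn; apply: conj_poly_in.
move: (e p ^ _) (e q ^ _) => ep eq Bep.
rewrite -!mulgA; congr (_ * _); rewrite !mulgA; congr (_ * _).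
by apply: BC => //; apply: subgroup_expgz.
Qed.

Lemma conj_polyN p : e (- p)%R = (e p)^-1.
Proof. by apply/esym/mulg1_eq; rewrite -conj_polyD subrr conj_poly0. Qed.

Lemma conj_poly1 : e 1 = tau.
Proof.
have := conj_poly_cons 0 1; rewrite mul0r add0r => ->.
by rewrite conj_poly0 conj1g mulg1.
Qed.

Lemma conj_polyX p : e ('X * p)%R = e p ^ z^-1.
Proof. by have := conj_poly_cons p 0; rewrite addr0 mulrC mul1g. Qed.

Lemma conj_polyXn i p : e ('X^i * p)%R = e p ^ (z ^- i).
Proof.
elim: i => [|i IH]; first by rewrite mul1r invg1 conjg1.
by rewrite exprS -mulrA conj_polyX IH -conjgM expgS invgM.
Qed.

Definition semidirect_val (u : {poly int} * nat) : G := e u.1 * z ^+ u.2.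

(** Moving [z^i] to the right past [tau^q] multiplies [q] by [X^i]: this is the law of the
    semidirect product of Z[x] by the natural numbers. *)
Definition semidirect_mul (u v : {poly int} * nat) : {poly int} * nat :=
  ((u.1 + 'X^(u.2) * v.1)%R, (u.2 + v.2)%N).

Lemma semidirect_valM u v :
  semidirect_val (semidirect_mul u v) = semidirect_val u * semidirect_val v.
Proof.
rewrite /semidirect_val /= conj_polyD conj_polyXn /conjg invgK expgnDr.
by rewrite !mulgA mulgVK.
Qed.

Lemma conj_poly_ideal : poly_ideal (fun p => e p = 1).
Proof.
split=> [|p q ep eq|p q]; first exact: conj_poly0.
  by rewrite conj_polyD ep eq mulg1.
move=> eq; apply: (polyX_closed (K := fun p => e p = 1)) => // [|p' r ep er|p' ep|p' ep].
- exact: conj_poly0.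
- by rewrite conj_polyD ep er mulg1.
- by rewrite conj_polyN ep invg1.
- by rewrite conj_polyX ep conj1g.
Qed.
End ConjugatePolynomials.

(** * The derived quotient of J *)

(** The Fox derivative of [t^j], where [t] has exponent [m]; for [j = n] it is the polynomial
    [T]. *)
Definition geom (m j : nat) : {poly int} := (\sum_(i < j) 'X^(i * m))%R.

Lemma geomS m j : geom m j.+1 = (1 + 'X^m * geom m j)%R.
Proof.
rewrite /geom big_ord_recl mul0n expr0 mulr_sumr; congr (_ + _)%R.
by apply: eq_bigr => i _; rewrite -exprD -mulSn.
Qed.

(** * Fox derivatives of words *)

Section Weights.
Variables (n m : nat) (k : int) (flip : bool).
Hypotheses (m_gt0 : (0 < m)%N) (nE : n = (if flip then 4 else 6)%N).

Let N := (n * m)%N.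

Local Lemma N_gt0 : (0 < N)%N. Proof. by rewrite /N nE; case: flip; lia. Qed.

(* A word of weight [(p, i)] stands for [tau^p z^i]: [p] is its Fox derivative with
   respect to [t], and exponents of [z] are natural numbers modulo [N], so that
   [z^-1] has exponent [N - 1]. *)
Definition letter_weight (l : bool * bool) : {poly int} * nat :=
  if l.1 then (0%R, if l.2 (+) flip then N.-1 else 1%N)
  else if l.2 then (- 'X^(N - m), (N - m)%N)%R else (1%R, m).

Definition word_weight (w : word bool) : {poly int} * nat :=
  foldr (fun l u => semidirect_mul (letter_weight l) u) (0%R, 0%N) w.

Lemma semidirect_mulA : associative semidirect_mul.
Proof.
move=> [p i] [q j] [r h]; rewrite /semidirect_mul /= addnA exprD; congr (_, _).
by ring.
Qed.

Lemma word_weight_cat u v :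
  word_weight (u ++ v) = semidirect_mul (word_weight u) (word_weight v).
Proof.
elim: u => [|l u IH] /=; last by rewrite IH semidirect_mulA.
by rewrite /semidirect_mul /= mul1r add0r add0n -surjective_pairing.
Qed.

Definition y_weight (a : int) : nat :=
  (`|a| * if (a < 0)%R (+) flip then N.-1 else 1)%N.

(** The number of letters [z^-1] in [y^a], each counted with exponent [N - 1] in place of [-1],
    hence the excess in multiples of [N]. *)
Definition y_wraps (a : int) : nat := if (a < 0)%R (+) flip then `|a|%N else 0%N.

Lemma y_weightE a :
  ((y_weight a)%:Z = (if flip then - a else a) + (y_wraps a * N)%N%:Z)%R.
Proof.
have := N_gt0; rewrite /y_weight /y_wraps => N0.
by case: flip; case: a => a /=; nia.
Qed.

Lemma word_weight_y a : word_weight (word_expz true a) = (0%R, y_weight a).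
Proof.
rewrite /word_expz /y_weight; elim: `|a|%N => [|j IH] //=.
by rewrite IH /semidirect_mul /= mulr0 addr0 mulSn.
Qed.

Lemma word_weight_t j : word_weight (word_expz false j%:Z) = (geom m j, (j * m)%N).
Proof.
rewrite /word_expz /=; elim: j => [|j IH] /=; first by rewrite /geom big_ord0.
by rewrite IH /semidirect_mul /= geomS mulSn.
Qed.

(** The polynomial [D]: the blocks [t^3] and [t^2] contribute their own derivatives, shifted by the
    exponent reached before them. *)
Definition rel_weight : {poly int} :=
  ('X^(y_weight (m%:Z - k)) * geom m 3 +
   'X^(y_weight (m%:Z - k) + 3 * m + y_weight k) * geom m 2)%R.

Definition rel_wraps : nat := (y_wraps (m%:Z - k) + y_wraps k)%N.

(** Up to wraps, [y^(m-k)] and [y^k] contribute [-m] if [z = y^-1] and [m] if [z = y], and [t^5]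
    contributes [5 m]. The choice of [z] makes the total [4 m] or [6 m], that is [N], in each
    case. *)
Lemma rel_weightE :
  (y_weight (m%:Z - k) + 3 * m + y_weight k + 2 * m = rel_wraps.+1 * N)%N.
Proof.
have := y_weightE k; have := y_weightE (m%:Z - k)%R.
rewrite /rel_wraps; have : N = (if flip then 4 * m else 6 * m)%N by rewrite /N nE; case: flip.
by case: flip => ->; nia.
Qed.

Lemma word_weight_rel :
  word_weight (word_expz true (m%:Z - k)%R ++ word_expz false 3 ++
               word_expz true k ++ word_expz false 2) =
  (rel_weight, (rel_wraps.+1 * N)%N).
Proof.
rewrite !word_weight_cat !word_weight_y (word_weight_t 3) (word_weight_t 2).
rewrite /semidirect_mul /= -rel_weightE !addnA add0r; congr (_, _).
by rewrite /rel_weight add0r mulrDr !exprD !mulrA.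
Qed.

Section Evaluation.
Variables (H : groupType) (f : bool -> H).
Let t := f false.
Let y := f true.
Let z := if flip then y^-1 else y.
Hypothesis f_rel : forall r, J_rels n m k r -> word_eval f r = 1.

Lemma t_order : t ^+ n = 1.
Proof. by rewrite -(f_rel (or_introl erefl)) word_eval_expz. Qed.

Lemma expgz_flip a : expgz y a = expgz z (if flip then - a else a)%R.
Proof. by rewrite /z; case: flip; rewrite // expgVz expgzN invgK. Qed.

Lemma expg_y_weight a : z ^+ y_weight a = expgz y a * z ^+ (y_wraps a * N).
Proof.
rewrite expgz_flip -[RHS]/(expgz _ _ * expgz _ (Posz _)) -expgzD -y_weightE.
by [].
Qed.

(** The second relator rewritten with natural powers of [z]: every wrap inserts a factor [z^N], and
    these are collected on the right because [z^N] is central. *)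
Lemma rel_wrapped : (forall x, commute x (z ^+ N)) ->
  z ^+ y_weight (m%:Z - k) * t ^+ 3 * z ^+ y_weight k * t ^+ 2 =
    z ^+ (rel_wraps * N).
Proof.
move=> zC; have zC' x i : commute x (z ^+ (i * N)).
  by rewrite mulnC expgnA; apply: commuteX.
have := f_rel (or_intror erefl).
rewrite !word_eval_cat !word_eval_expz -/t -/y /= => rel1.
rewrite !expg_y_weight /rel_wraps mulnDl expgnDr.
rewrite -!mulgA -(zC' (t ^+ 2)) -(zC' (_ * _)) -[RHS]mul1g -[in RHS]rel1 -!mulgA.
by rewrite -(zC' (z ^+ _)).
Qed.
End Evaluation.
End Weights.

Section PolyIdeal.
Variable I : {poly int} -> Prop.
Hypothesis Iid : poly_ideal I.

Lemma poly_ideal0 : I 0%R. Proof. by case: Iid. Qed.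
Lemma poly_idealD p q : I p -> I q -> I (p + q)%R. Proof. by case: Iid => _ + _; apply. Qed.
Lemma poly_idealM p q : I q -> I (p * q)%R. Proof. by case: Iid => _ _; apply. Qed.
Lemma poly_idealN p : I p -> I (- p)%R.
Proof. by rewrite -mulN1r; apply: poly_idealM. Qed.
Lemma poly_idealB p q : I p -> I q -> I (p - q)%R.
Proof. by move=> Ip Iq; apply: poly_idealD => //; apply: poly_idealN. Qed.

Lemma poly_ideal_Xmod N i j : I ('X^N - 1)%R -> i = j %[mod N] -> I ('X^i - 'X^j)%R.
Proof.
move=> IN; have mod0 h : I ('X^h - 'X^(h %% N))%R.
  rewrite {1}(divn_eq h N) exprD mulnC exprM -[X in (_ - X)%R]mul1r -mulrBl mulrC.
  by apply: poly_idealM; rewrite subrX1 mulrC; apply: poly_idealM.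
move=> ij; have -> : ('X^i - 'X^j = ('X^i - 'X^(i %% N)) - ('X^j - 'X^(j %% N)) :> {poly int})%R.
  by rewrite ij; ring.
by apply: poly_idealB.
Qed.
End PolyIdeal.

(** * Weights as invariants of J *)

Section DerivedQuotient.
Variables (n m : nat) (k : int) (flip : bool).
Hypotheses (m_gt0 : (0 < m)%N) (nE : n = (if flip then 4 else 6)%N).

Let N := (n * m)%N.
Let weight := word_weight n m flip.
Let G := J n m k.
Let G1 := derived [set: G].
Let G2 := derived G1.

(** [I] is to be the annihilator of [tau]. That it contains [X^N - 1], [T] and [D] makes weights
    modulo [I] invariants of group elements; [I_min], applied to the true annihilator in [J / J''],
    shows that [I] kills [tau]. *)
Variable I : {poly int} -> Prop.
Hypotheses (Iid : poly_ideal I) (I_XN : I ('X^N - 1)%R) (I_geom : I (geom m n)).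
Hypothesis I_rel : I (rel_weight n m k flip).
Hypothesis I_min : forall K, poly_ideal K -> K (('X - 1) * geom m n)%R ->
  K (rel_weight n m k flip - geom m n)%R -> K (geom m n) /\ (forall p, I p -> K p).

Let N0 : (0 < N)%N. Proof. by rewrite /N nE; case: flip; lia. Qed.
Let mN : (m <= N)%N. Proof. by rewrite /N nE; case: flip; lia. Qed.

Definition weight_eq (u v : {poly int} * nat) : Prop :=
  I (u.1 - v.1)%R /\ u.2 = v.2 %[mod N].

Lemma weight_eq_refl u : weight_eq u u.
Proof. by split; rewrite // subrr; apply: poly_ideal0. Qed.

Lemma weight_eq_sym u v : weight_eq u v -> weight_eq v u.
Proof. by case=> uv1 uv2; split; rewrite // -opprB; apply: poly_idealN. Qed.

Lemma weight_eq_trans u v w : weight_eq u v -> weight_eq v w -> weight_eq u w.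
Proof.
case=> uv1 uv2 [vw1 vw2]; split; last by rewrite uv2.
have -> : (u.1 - w.1 = (u.1 - v.1) + (v.1 - w.1))%R by ring.
exact: poly_idealD.
Qed.

Lemma weight_eq_mul u u' v v' : weight_eq u u' -> weight_eq v v' ->
  weight_eq (semidirect_mul u v) (semidirect_mul u' v').
Proof.
case=> u1 u2 [v1 v2]; split=> /=; last by rewrite -modnDm u2 v2 modnDm.
have -> : (u.1 + 'X^(u.2) * v.1 - (u'.1 + 'X^(u'.2) * v'.1) =
  (u.1 - u'.1) + ('X^(u.2) * (v.1 - v'.1) + v'.1 * ('X^(u.2) - 'X^(u'.2))))%R by ring.
apply: (poly_idealD Iid) => //; apply: (poly_idealD Iid); apply: (poly_idealM Iid) => //.
exact: (poly_ideal_Xmod Iid I_XN).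
Qed.

(** As [weight_eq] is a congruence, it is enough that each inserted word has trivial weight: a
    cancelling pair by [X^N = 1], the two relators by [I_geom] and [I_rel]. *)
Lemma weight_pres_eq u v : pres_eq (J_rels n m k) u v -> weight_eq (weight u) (weight v).
Proof.
have catE := word_weight_cat n m flip.
have mul0 u' : semidirect_mul (0%R, 0%N) u' = u'.
  by rewrite /semidirect_mul /= mul1r add0r add0n -surjective_pairing.
have insert u' w v' : weight_eq (weight w) (0%R, 0%N) ->
    weight_eq (weight (u' ++ w ++ v')) (weight (u' ++ v')).
  move=> w0; rewrite /weight !catE; apply: weight_eq_mul; first exact: weight_eq_refl.
  rewrite -[X in weight_eq _ X]mul0; apply: weight_eq_mul => //; exact: weight_eq_refl.
elim=> {u v} [u|u v _ uv|u v w _ uv _ vw|u [[] b] v|u r v [] ->].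
- exact: weight_eq_refl.
- exact: weight_eq_sym.
- exact: weight_eq_trans vw.
- apply: insert; split; rewrite /= ?(mulr0, add0r, addr0, subr0); first exact: (poly_ideal0 Iid).
  rewrite -/N; have -> : ((if b (+) flip then N.-1 else 1) +
    ((if ~~ b (+) flip then N.-1 else 1) + 0) = N)%N by case: b flip => [] [] /=; lia.
  by rewrite modnn mod0n.
- apply: insert; split; rewrite /= ?mulr0 ?add0r ?subr0 ?addr0.
    case: b => /=.
      by rewrite mulr1 addNr; apply: (poly_ideal0 Iid).
    by rewrite mulrN -exprD subnKC // -opprB; apply: (poly_idealN Iid).
  rewrite -/N addn0; case: b => /=; rewrite ?subnK ?subnKC //; by rewrite modnn mod0n.
- apply: insert; rewrite /weight word_weight_t; split; first by rewrite subr0.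
  by rewrite /= modnn mod0n.
- apply: insert; rewrite /weight word_weight_rel //; split; first by rewrite subr0.
  by rewrite /= modnMl mod0n.
Qed.

(** Read off a chosen word for [g], hence meaningful only up to [weight_eq]. *)
Definition grp_weight (g : G) : {poly int} * nat := weight (pres_repr g).

Lemma grp_weight_pi w : weight_eq (grp_weight (pres_pi _ w : G)) (weight w).
Proof. exact/weight_pres_eq/pres_repr_pi. Qed.

Lemma grp_weightM (g h : G) :
  weight_eq (grp_weight (g * h)) (semidirect_mul (grp_weight g) (grp_weight h)).
Proof.
apply: weight_eq_trans (grp_weight_pi _) _.
by rewrite /weight word_weight_cat; apply: weight_eq_refl.
Qed.

Lemma grp_weight1 : weight_eq (grp_weight 1) (0%R, 0%N).
Proof. exact: (grp_weight_pi [::]). Qed.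

Local Notation wpoly g := (grp_weight g).1.
Local Notation wexp g := (grp_weight g).2.

Lemma wexpM (g h : G) : (wexp (g * h) = wexp g + wexp h %[mod N])%N.
Proof. by have [] := grp_weightM g h. Qed.

Lemma wexp1 : (N %| wexp 1)%N.
Proof. by have [_ /= E] := grp_weight1; rewrite /dvdn E mod0n. Qed.

Lemma wexpV (g : G) : (N %| wexp g^-1 + wexp g)%N.
Proof. by rewrite /dvdn -wexpM mulVg; apply: wexp1. Qed.

(** The exponent is a morphism to the abelian group of integers modulo [N]. *)
Lemma wexp_derived g : G1 g -> (N %| wexp g)%N.
Proof.
pose K := [set g | (N %| wexp g)%N] : set G.
suff : G1 `<=` K by apply.
apply: derived_ind => [|x y _ _]; rewrite /K /=.
  split=> [|x y xN yN|x xN] /=; first exact: wexp1.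
    by rewrite /dvdn wexpM; apply: dvdn_add.
  by rewrite -(dvdn_addl _ xN) wexpV.
rewrite /commg /conjg /dvdn wexpM -modnDmr wexpM modnDmr addnA -modnDmr wexpM modnDmr.
by rewrite addnACA; apply: dvdn_add; apply: wexpV.
Qed.

(** When [N] divides the exponent of [u], the twist [X^i] is 1 modulo [I]; hence [wpoly] is additive
    on [G1]. *)
Lemma weight_eq_add u v w : weight_eq w (semidirect_mul u v) -> (N %| u.2)%N ->
  I (w.1 - (u.1 + v.1))%R.
Proof.
case: u v w => [p i] [q j] [r h] [/= E _] iN.
have -> : (r - (p + q) = (r - (p + 'X^i * q)) + q * ('X^i - 'X^0))%R by ring.
apply: (poly_idealD Iid) => //; apply: (poly_idealM Iid).
by apply: (poly_ideal_Xmod Iid I_XN); rewrite mod0n; apply/eqP.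
Qed.

Lemma wpolyM (g h : G) : G1 g -> I (wpoly (g * h) - (wpoly g + wpoly h))%R.
Proof. by move=> /wexp_derived; apply: weight_eq_add; apply: grp_weightM. Qed.

Lemma wpoly1 : I (wpoly 1).
Proof. by have [+ _] := grp_weight1; rewrite subr0. Qed.

Lemma poly_ideal_mod (p q : {poly int}) : I (p - q)%R -> I p <-> I q.
Proof.
move=> pq; split=> [p0|q0]; last by rewrite -(subrK q p); apply: (poly_idealD Iid).
by rewrite -(subKr p q); apply: (poly_idealB Iid).
Qed.

Lemma derivedV (g : G) : G1 g -> G1 g^-1.
Proof. by have [_ _] := derived_subgroup [set: G]; apply. Qed.

Lemma derivedM (g h : G) : G1 g -> G1 h -> G1 (g * h).
Proof. by have [_ + _] := derived_subgroup [set: G]; apply. Qed.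

Lemma wpolyV (g : G) : G1 g -> I (wpoly g^-1 + wpoly g)%R.
Proof.
move=> /derivedV Gg; apply/(poly_ideal_mod (wpolyM g Gg)); rewrite mulVg; apply: wpoly1.
Qed.

(** On [G1] the polynomial is a morphism to the abelian group [Z[x] / I], so it vanishes on
    commutators. *)
Lemma wpoly_derived2 g : G2 g -> G1 g /\ I (wpoly g).
Proof.
pose K := [set g | G1 g /\ I (wpoly g)] : set G.
suff : G2 `<=` K by apply.
have G1n : is_subgroup G1 := derived_subgroup _.
have KM x y : K x -> K y -> K (x * y).
  move=> [Gx Ix] [Gy Iy]; split; first exact: derivedM.
  by apply/(poly_ideal_mod (wpolyM y Gx)); apply: (poly_idealD Iid).
apply: derived_ind => [|x y Gx Gy].
  split=> // [|x [Gx Ix]]; first by split; [case: G1n|apply: wpoly1].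
  split; first exact: derivedV.
  rewrite -(addrK (wpoly x) (wpoly _)); apply: (poly_idealB Iid) => //.
  exact: wpolyV.
have GV := derivedV; have GM := derivedM.
split; first exact: derivedR.
have Ix := wpolyV Gx; have Iy := wpolyV Gy.
have E1 := wpolyM y Gx.
have E2 := wpolyM (x * y) (GV _ Gy).
have E3 := wpolyM (y^-1 * (x * y)) (GV _ Gx).
rewrite /commg /conjg; move: Ix Iy E1 E2 E3.
move: (wpoly (x^-1 * _)) (wpoly (y^-1 * _)) (wpoly (x * y)) => a b c.
move: (wpoly x) (wpoly y) (wpoly x^-1) (wpoly y^-1) => d e d' e' Id Ie E1 E2 E3.
have -> : (a = (a - (d' + b)) + (b - (e' + c)) + (c - (d + e)) + (d' + d) + (e' + e))%R.
  by ring.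
by do 4!(apply: (poly_idealD Iid) => //).
Qed.

(** A word for [tau = t z^-m]: [z^-m] is [y^m] if [z = y^-1] and [y^-m] if [z = y]. *)
Local Notation tau_word :=
  ((false, false) :: word_expz true (if flip then m%:Z else - m%:Z)%R).

(** The polynomials attained on [G1] modulo [I] form an additive group, stable under [X] through
    conjugation by [z], and contain the polynomial 1 of [tau]. *)
Lemma wpoly_surj p : G1 (pres_pi _ tau_word : G) ->
  exists2 g : G, G1 g & I (wpoly g - p)%R.
Proof.
set tau := pres_pi _ _ => Gtau; rewrite -[p]mulr1.
have GV := derivedV; have GM := derivedM.
have G1n : is_subgroup G1 := derived_subgroup _.
apply: (polyX_closed (K := fun p => exists2 g : G, G1 g & I (wpoly g - p)%R)).
- by exists 1; [case: G1n|rewrite subr0; apply: wpoly1].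
- move=> {}p q [g Gg Ig] [h Gh Ih]; exists (g * h); first exact: GM.
  have := wpolyM h Gg; move: (wpoly (g * h)) Ig Ih => a.
  move: (wpoly g) (wpoly h) => b c Ib Ic Ia.
  have -> : (a - (p + q) = (a - (b + c)) + (b - p) + (c - q))%R by ring.
  by do 2!(apply: (poly_idealD Iid) => //).
- move=> {}p [g Gg Ig]; exists g^-1; first exact: GV.
  have := wpolyV Gg; move: (wpoly g^-1) (wpoly g) Ig => a b Ib Iab.
  have -> : (a - - p = (a + b) - (b - p))%R by ring.
  exact: (poly_idealB Iid).
- move=> {}p [g Gg Ig].
  (* The conjugating element is [z^-1], so that the conjugate is [z g z^-1]. *)
  exists (g ^ (pres_pi _ [:: (true, ~~ flip)] : G)).
    by apply: derived_normal.
  set v := (pres_pi _ _ : G); rewrite /conjg.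
  set u := v^-1; have uP : u = pres_pi _ [:: (true, ~~ ~~ flip)] := pres_invE _ _.
  have uE : weight_eq (grp_weight u) (0%R, 1%N).
    rewrite uP; apply: weight_eq_trans (grp_weight_pi _) _; rewrite /weight /= /letter_weight /=.
    rewrite /semidirect_mul /= mulr0 addr0 addn0 negbK addbb.
    exact: weight_eq_refl.
  have vE : weight_eq (grp_weight v) (0%R, N.-1).
    apply: weight_eq_trans (grp_weight_pi _) _; rewrite /weight /= /letter_weight /=.
    rewrite /semidirect_mul /= mulr0 addr0 addn0 addNb addbb.
    exact: weight_eq_refl.
  have [+ _] := weight_eq_trans (grp_weightM u (g * v))
    (weight_eq_mul uE (weight_eq_trans (grp_weightM g v)
      (weight_eq_mul (weight_eq_refl _) vE))).
  move: (wpoly (u * _)) => a /=; rewrite mulr0 addr0 add0r expr1.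
  move: (wpoly g) Ig => b Ib Ia.
  have -> : (a - 'X * p = (a - 'X * b) + 'X * (b - p))%R by ring.
  by apply: (poly_idealD Iid) => //; apply: (poly_idealM Iid).
- exists tau => //; have [+ _] := grp_weight_pi tau_word.
  by rewrite /weight /= word_weight_y /semidirect_mul /= mulr0 addr0.
Qed.

Lemma word_eval_tau (H : groupType) (f : bool -> H) :
  word_eval f tau_word = f false * (if flip then (f true)^-1 else f true) ^- m.
Proof.
rewrite word_eval_cons word_eval_expz (expgz_flip flip f); congr (_ * _).
by case: flip; rewrite ?opprK expgzN.
Qed.

(** In an abelian group the second relator reads [t^5 z^N = z^(5m)]. With [t^4 = 1] and [N = 4 m],
    or [t^6 = 1] and [N = 6 m], this gives [t = z^m]. *)
Lemma abelian_tau (H : groupType) (f : bool -> H) :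
  (forall x y : H, commute x y) ->
  (forall r, J_rels n m k r -> word_eval f r = 1) -> word_eval f tau_word = 1.
Proof.
move=> C f_rel; rewrite word_eval_tau; set z := if flip then _ else _.
have rel := rel_wrapped m_gt0 nE f_rel (fun x => C x _).
have relE := rel_weightE k m_gt0 nE.
have tn := t_order f_rel.
move: rel relE tn; rewrite -/z -/N; set t := f false.
set a := y_weight _ _ _ _; set b := y_weight _ _ _ _; set w := rel_wraps _ _ _ => rel relE tn.
have CA x y v : x * (y * v) = y * (x * v) :> H by rewrite !mulgA (C x).
have E : t ^+ 5 * z ^+ (w.+1 * N) = z ^+ (w * N) * z ^+ (5 * m).
  have -> : (w.+1 * N = a + (b + 5 * m))%N by rewrite -relE; lia.
  rewrite -rel (expgnDr t 3 2) !expgnDr; move: (t ^+ 3) (t ^+ 2) => t3 t2.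
  by rewrite -!mulgA (CA (z ^+ a) t3) (CA (z ^+ b) t2) (CA (z ^+ a) t2).
have {}E : t ^+ 5 * z ^+ N = z ^+ (5 * m).
  apply: (mulgI (z ^+ (w * N))); rewrite -E mulSn expgnDr CA.
  by rewrite (C (z ^+ (w * N)) (z ^+ N)).
suff -> : t = z ^+ m by rewrite mulgV.
move: E tn; rewrite /N nE; case: (flip) => E tn.
  apply: (mulIg (z ^+ (4 * m))); rewrite -expgnDr -mulSn -E.
  by rewrite (expgnDr t 4 1) tn mul1g.
have {}E : t ^+ 5 * z ^+ m = 1.
  apply: (mulIg (z ^+ (5 * m))); rewrite mul1g -mulgA -expgnDr -mulSn.
  exact: E.
by rewrite -[RHS]mul1g -tn (expgSr t 5) -mulgA C -mulgA (C _ (t ^+ 5)) E mulg1.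
Qed.

Section QuotientRelations.
Variable K : set G.
Hypotheses (Ksub : is_subgroup K) (Kn : is_normal K).

Definition quot_gen (x : bool) : presented (quot_rels K) :=
  quot_pi K (pres_gen (J_rels n m k) x : G).

Lemma word_eval_quot_gen w : word_eval quot_gen w = quot_pi K (pres_pi _ w : G).
Proof.
by rewrite -[pres_pi _ w]word_eval_gen (morph_word_eval _ _ (quot_piM Ksub)).
Qed.

Lemma quot_gen_rel r : J_rels n m k r -> word_eval quot_gen r = 1.
Proof.
move=> rr; rewrite word_eval_quot_gen -[pres_pi _ r]word_eval_gen pres_gen_rel //.
by apply/(quot_pi_eq1 Ksub Kn); case: Ksub.
Qed.
End QuotientRelations.

Lemma G1_normal : is_normal G1.
Proof. exact: derived_normal. Qed.

(** [abelian_tau] is applied to [J / J']. *)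
Lemma tau_derived : G1 (pres_pi _ tau_word : G).
Proof.
have G1n : is_subgroup G1 := derived_subgroup _.
apply/(quot_pi_eq1 G1n G1_normal); rewrite -(word_eval_quot_gen G1n).
apply: abelian_tau => [x y|r]; last exact: (quot_gen_rel G1n G1_normal).
have [g ->] := quot_pi_surj G1n x; have [h ->] := quot_pi_surj G1n y.
rewrite /commute -!(quot_piM G1n) commgC (quot_piM G1n).
suff -> : quot_pi G1 [~ g, h] = 1 by rewrite mulg1.
by apply/(quot_pi_eq1 G1n G1_normal); apply: derivedR.
Qed.

(** In [J / J''] every word turns out to have the value [tau^p z^i] given by its weight [(p, i)];
    for [g] in [J'] with polynomial in [I], both factors are trivial. *)
Lemma wpoly_derived2_inv g : G1 g -> I (wpoly g) -> G2 g.
Proof.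
have G1n : is_subgroup G1 := derived_subgroup _.
have G2n : is_subgroup G2 := derived_subgroup _.
have G2N : is_normal G2 := derived_normal G1_normal.
have piM := quot_piM G2n; have pi1 := quot_pi_eq1 G2n G2N.
have piV x : quot_pi G2 x^-1 = (quot_pi G2 x)^-1.
  by apply/esym/mulg1_eq; rewrite -piM mulgV; apply/pi1; case: G2n.
pose B := [set quot_pi G2 x | x in G1].
have Bsub : is_subgroup B.
  have [G11 G1M G1V] := G1n; split.
  - by exists 1 => //; apply/pi1; case: G2n.
  - by move=> _ _ [x Gx <-] [y Gy <-]; exists (x * y); [apply: G1M|apply: piM].
  - by move=> _ [x Gx <-]; exists x^-1; [apply: G1V|apply: piV].
have Bn : is_normal B.
  move=> _ q [x Gx <-]; have [h ->] := quot_pi_surj G2n q.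
  by exists (x ^ h); [apply: G1_normal|rewrite /conjg !piM piV].
have BC x y : B x -> B y -> commute x y.
  move=> [g' Gg <-] [h Gh <-]; rewrite /commute -!piM commgC piM.
  suff -> : quot_pi G2 [~ g', h] = 1 by rewrite mulg1.
  by apply/pi1; apply: derivedR.
pose f := quot_gen G2; have f_rel := quot_gen_rel G2n G2N.
have fE := word_eval_quot_gen G2n.
pose t := f false; pose z := if flip then (f true)^-1 else f true.
pose tau := word_eval f tau_word.
have tauE : t = tau * z ^+ m by rewrite /tau word_eval_tau mulgVK.
have Btau : B tau by exists (pres_pi _ tau_word); [apply: tau_derived|rewrite -fE].
pose val := semidirect_val tau z; pose e := conj_poly tau z.
have valM u v : val (semidirect_mul u v) = val u * val v.
  exact: (semidirect_valM z Bsub Bn Btau BC).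
have val_t : val (1%R, m) = t by rewrite /val /semidirect_val /= conj_poly1.
have val_z i : val (0%R, i) = z ^+ i.
  by rewrite /val /semidirect_val /= conj_poly0 mul1g.
have val_geom j : t ^+ j = val (geom m j, (j * m)%N).
  elim: j => [|j IH]; first by rewrite /geom big_ord0 val_z.
  by rewrite expgS IH -{1}val_t -valM /semidirect_mul /= geomS mulSn.
have eD p q : e (p + q)%R = e p * e q := conj_polyD z Bsub Bn Btau BC p q.
have eN p : e (- p)%R = (e p)^-1 := conj_polyN z Bsub Bn Btau BC p.
have eX p : e ('X * p)%R = e p ^ z^-1 := conj_polyX tau z p.
(* The first relator [t^n = 1] has weight [(T, N)]. *)
have zN : z ^+ N = e (- geom m n)%R.
  by rewrite eN; apply/esym/mulg1_eq; rewrite -(t_order f_rel) -/t val_geom.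
have BzN : B (z ^+ N) by rewrite zN; apply: conj_poly_in.
(* As a power of [z] that lies in the abelian group [B], [z^N] commutes with [z] and [tau], hence
   with both generators. *)
have zNC q : commute q (z ^+ N).
  have [h ->] := quot_pi_surj G2n q; rewrite -[h]pres_reprK -fE.
  have zC : commute (z ^+ N) z by apply/commute_sym/commuteX/commute_refl.
  have tC : commute (z ^+ N) t.
    by rewrite tauE; apply: commuteM; [apply: BC|apply: commuteX].
  have yC : commute (z ^+ N) (f true).
    by move: zC; rewrite /z; case: (flip) => // /commuteV; rewrite invgK.
  apply: commute_sym; elim: (pres_repr h) => [|[x b] u IH].
    by rewrite word_eval_nil; apply: commute1.
  rewrite word_eval_cons; apply: commuteM => //.
  by case: x; case: b => //; apply: commuteV.
(* The annihilator of [tau] contains [(X - 1) T], because [z] commutes with [z^N = e (- T)], and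
   [D - T], because the second relator reads [e D = z^-N = e T]. *)
have [e_geom IK] : e (geom m n) = 1 /\ forall p, I p -> e p = 1.
  apply: (I_min (K := fun p => e p = 1)).
  - exact: (conj_poly_ideal z Bsub Bn Btau BC).
  - rewrite mulrBl mul1r eD eX -zN -[e _]invgK -eN -zN conjVg conjXg.
    by rewrite /conjg mulgV mulg1 invgK mulVg.
  - rewrite eD -zN -[LHS](mulgK (z ^+ (rel_wraps m k flip * N))).
    rewrite -(mulgA (e _)) -expgnDr -mulSn.
    suff -> : e (rel_weight n m k flip) * z ^+ ((rel_wraps m k flip).+1 * N) =
              z ^+ (rel_wraps m k flip * N) by rewrite mulgV.
    rewrite -[LHS]/(val (_, _)) -(word_weight_rel k m_gt0 nE).
    rewrite -(rel_wrapped m_gt0 nE f_rel zNC) -/z -/t.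
    rewrite !word_weight_cat !word_weight_y (word_weight_t _ _ _ 3) (word_weight_t _ _ _ 2).
    by rewrite !valM -!val_geom !val_z !mulgA.
have zN1 : z ^+ N = 1 by rewrite zN eN e_geom invg1.
have evalE w : word_eval f w = val (weight w).
  elim: w => [|[x b] w IH]; first by rewrite word_eval_nil val_z.
  rewrite word_eval_cons /weight /= valM IH; congr (_ * _).
  case: x; rewrite /letter_weight /=; last first.
    case: b => //; rewrite -/t -val_t; apply/mulg1_eq; rewrite -valM.
    rewrite /semidirect_mul /= mulrN -exprD subnKC // /val /semidirect_val /= zN1 mulg1.
    rewrite -/(e _) eD eN -['X^_]mulr1 /e conj_polyXn zN1 invg1 conjg1 conj_poly1.
    exact: mulgV.
  have zV : z ^+ N.-1 = z^-1.
    by apply/esym/mulg1_eq; rewrite -expgS prednK.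
  by rewrite val_z -/N; move: zV; rewrite /z; case: (flip); case: b => //= ->; rewrite ?invgK.
move=> Gg Ig; apply/pi1; rewrite -[g]pres_reprK -fE evalE.
rewrite -[LHS]/(e (wpoly g) * z ^+ (wexp g)) (IK _ Ig) mul1g.
by have /dvdnP[q ->] := wexp_derived Gg; rewrite mulnC expgnA zN1 expg1n.
Qed.

(** The preceding lemmas identify [J' / J''] with [Z[x] / I] through [wpoly], and [c] numbers the
    latter. *)
Lemma derived_quotient_card (c : {poly int} -> nat) (a : nat) :
  (forall p, (c p < a)%N) -> (forall i, (i < a)%N -> exists p, c p = i) ->
  (forall p q, c p = c q <-> I (p - q)%R) ->
  derived_quotient G #= `I_a.
Proof.
move=> c_lt c_surj cE.
apply: (@card_lcosets G G1 G2 (fun g => c (wpoly g))) => [x y Gx Gy||x _|i /c_surj[p <-]] //.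
- have Gxy : G1 (x^-1 * y) by apply: derivedM => //; apply: derivedV.
  have Ixy := wpolyM y (derivedV Gx); have Ix := wpolyV Gx.
  have E : I (wpoly (x^-1 * y) - (wpoly y - wpoly x))%R.
    move: Ixy Ix; move: (wpoly (_ * _)) (wpoly x^-1) (wpoly x) (wpoly y) => u v w r Iu Iv.
    have -> : (u - (r - w) = (u - (v + r)) + (v + w))%R by ring.
    exact: (poly_idealD Iid).
  split=> [/cE Iyx|/wpoly_derived2[_ I0]]; last first.
    by apply/cE; rewrite -opprB; apply: (poly_idealN Iid); apply/(poly_ideal_mod E).
  apply: wpoly_derived2_inv => //; apply/(poly_ideal_mod E).
  by rewrite -opprB; apply: (poly_idealN Iid).
- exact: derived_subgroup.
- have [g Gg Ig] := wpoly_surj p tau_derived.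
  by exists g => //; apply/cE.
Qed.
End DerivedQuotient.

Local Close Scope group_scope.

(** * The annihilator as the ideal (f, g) *)

Definition ideal2 (f g p : {poly int}) : Prop := exists a b, p = a * f + b * g.

Lemma ideal2_ideal f g : poly_ideal (ideal2 f g).
Proof.
split=> [|p q [a [b ->]] [c [d ->]]|p q [a [b ->]]].
- by exists 0, 0; ring.
- by exists (a + c), (b + d); ring.
- by exists (p * a), (p * b); ring.
Qed.

Lemma ideal2l f g : ideal2 f g f. Proof. by exists 1, 0; ring. Qed.
Lemma ideal2r f g : ideal2 f g g. Proof. by exists 0, 1; ring. Qed.

Lemma ideal2_min f g (K : {poly int} -> Prop) p :
  poly_ideal K -> K f -> K g -> ideal2 f g p -> K p.
Proof.
by move=> Kid Kf Kg [a [b ->]]; apply: (poly_idealD Kid); apply: (poly_idealM Kid).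
Qed.

Lemma geom_sub1 m n : 'X^(n * m) - 1 = ('X^m - 1) * geom m n.
Proof.
rewrite mulnC exprM subrX1; congr (_ * _); apply: eq_bigr => i _.
by rewrite -exprM mulnC.
Qed.

Lemma y_weight_mod n m flip a (c d : nat) : (0 < m)%N -> n = (if flip then 4 else 6)%N ->
  ((if flip then - a else a) + c%:Z = d%:Z %[mod (n * m)%N])%Z ->
  (y_weight n m flip a + c = d %[mod n * m])%N.
Proof.
move=> m_gt0 nE /eqP; rewrite eqz_mod_dvd => /dvdzP[q qE].
apply/eqP; rewrite -eqz_nat -!modz_nat eqz_mod_dvd; apply/dvdzP.
exists ((y_wraps flip a)%:Z + q); rewrite mulrDl -qE PoszD (y_weightE m_gt0 nE a) PoszM.
by ring.
Qed.

Section Relations.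
Variables (n m : nat) (k : int) (k' : nat) (flip : bool).
Hypotheses (m_gt0 : (0 < m)%N) (nE : n = (if flip then 4 else 6)%N).
Hypothesis k'E : (k'%:Z = k %[mod (n * m)%N%:Z])%Z.

Variable K : {poly int} -> Prop.
Hypotheses (Kid : poly_ideal K).

Let D := rel_weight n m k flip.
Let a := y_weight n m flip (m%:Z - k).
Let b := y_weight n m flip k.

Lemma geom_XN : K (geom m n) -> K ('X^(n * m) - 1).
Proof. by rewrite geom_sub1; apply: (poly_idealM Kid). Qed.

(* [D - T] is [1] or [-1] modulo [X - 1], which kills [T]. *)
Lemma geom_in : K (('X - 1) * geom m n) -> K (D - geom m n) -> K (geom m n).
Proof.
move=> KX KD; pose f := D - geom m n.
have f1 : f.[1] = if flip then 1 else -1.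
  rewrite /f /D /rel_weight nE; case: (flip); rewrite !geomS /geom !big_ord0 !hornerE !expr1n;
  by [].
have /factor_theorem[q qE] : root (f - (f.[1])%:P) 1 by rewrite rootE !hornerE subrr.
have : K (f.[1]%:P * geom m n).
  have -> : f.[1]%:P * geom m n = geom m n * f - q * (('X - 1%:P) * geom m n).
    by rewrite mulrA -qE; ring.
  by apply: (poly_idealB Kid); apply: (poly_idealM Kid).
rewrite f1; case: (flip); rewrite ?mul1r //.
by rewrite polyCN mulN1r => /(poly_idealN Kid); rewrite opprK.
Qed.

(** [X] is invertible modulo [X^N - 1]. *)
Lemma Xn_cancel i p : K ('X^(n * m) - 1) -> K ('X^i * p) -> K p.
Proof.
move=> KN Kp; have N0 : (0 < n * m)%N by rewrite nE muln_gt0 m_gt0; case: flip.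
have /(poly_idealM Kid p) K1 : K ('X^(i * (n * m)) - 'X^0).
  by apply: (poly_ideal_Xmod Kid KN); rewrite modnMl mod0n.
have -> : p = 'X^(i * (n * m).-1) * ('X^i * p) - p * ('X^(i * (n * m)) - 'X^0).
  by rewrite -{2}(prednK N0) mulnS exprD expr0; ring.
by apply: (poly_idealB Kid) => //; apply: (poly_idealM Kid).
Qed.

Let u : {poly int} := 'X^m.

Lemma rel_exps : (a + 3 * m + b + 2 * m = (rel_wraps m k flip).+1 * (n * m))%N.
Proof. exact: rel_weightE. Qed.

Lemma rel_weight_geom : D = 'X^a * (1 + u + u ^+ 2) + 'X^(a + 3 * m + b) * (1 + u).
Proof. by rewrite /D /rel_weight !geomS /geom !big_ord0 -/a -/b -/u; ring. Qed.

Lemma Xn_k' (c d : nat) :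
  ((if flip then - (m%:Z - k) else m%:Z - k) + c%:Z = d%:Z %[mod (n * m)%N])%Z ->
  K ('X^(n * m) - 1) -> K ('X^(a + c) - 'X^d).
Proof.
by move=> E KN; apply: (poly_ideal_Xmod Kid KN); apply: y_weight_mod.
Qed.

(** The whole relator has exponent 0 modulo [N], so the prefix before [t^2] has exponent [-2 m]. *)
Lemma Xn_tail (d : nat) : (d + 2 * m = n * m)%N -> K ('X^(n * m) - 1) ->
  K ('X^(a + 3 * m + b) - 'X^d).
Proof.
move=> dE KN; apply: (poly_ideal_Xmod Kid KN); apply/eqP.
by rewrite -(eqn_modDr (2 * m)) rel_exps dE modnMl modnn.
Qed.

Section Flip.
Hypothesis flipT : flip.
Let f : {poly int} := 1 + 'X^m - 'X^k'.
Let g : {poly int} := 1 + 'X^(2 * m).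

Let n4 : n = 4. Proof. by rewrite nE flipT. Qed.
Let gE : g = 1 + u ^+ 2. Proof. by rewrite /g mulnC exprM. Qed.
Let geomE : geom m n = (1 + u) * g.
Proof. by rewrite n4 gE !geomS /geom !big_ord0 -/u; ring. Qed.

(** Modulo [g] one has [u^2 = -1], so the first term of [D] becomes [X^(a+m) = X^k'] and the second
    [-(1 + u)]; thus [D = -f]. *)
Lemma rel_geom4 : K g -> [/\ K ('X^(n * m) - 1), K (geom m n) & K (D + f)].
Proof.
move=> Kg; have Kgeom : K (geom m n) by rewrite geomE; apply: (poly_idealM Kid).
have KN := geom_XN Kgeom; split=> //.
have K1 : K ('X^(a + m) - 'X^k').
  apply: Xn_k' => //; rewrite flipT opprB subrK; apply/esym; exact: k'E.
have K2 : K ('X^(a + 3 * m + b) - 'X^(2 * m)).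
  by apply: Xn_tail => //; rewrite n4; lia.
have -> : D + f = ('X^a + 1 + u) * g + ('X^(a + m) - 'X^k') +
    (1 + u) * ('X^(a + 3 * m + b) - 'X^(2 * m)).
  by rewrite rel_weight_geom /f gE (exprD _ a m) (mulnC 2) (exprM _ m) -/u; ring.
by apply: (poly_idealD Kid); [apply: (poly_idealD Kid)|] => //; apply: (poly_idealM Kid).
Qed.

Lemma ideal4_min : K (('X - 1) * geom m n) -> K (D - geom m n) -> K f /\ K g.
Proof.
move=> KX KD; have Kgeom := geom_in KX KD; have KN := geom_XN Kgeom.
have {}KD : K D by rewrite -(subrK (geom m n) D); apply: (poly_idealD Kid).
suff Kg : K g.
  split=> //; have [_ _ KDf] := rel_geom4 Kg.
  by rewrite -[f](addKr D) addrC; apply: (poly_idealB Kid).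
apply: (@Xn_cancel (a + 2 * m)) => //.
(* As [T = (1 + u) g], subtracting multiples of [T] from [g D] leaves only the term [X^a u^2 g]. *)
have -> : 'X^(a + 2 * m) * g = g * D - ('X^a + 'X^(a + 3 * m + b)) * geom m n.
  by rewrite rel_weight_geom geomE exprD [in LHS]mulnC exprM -/u; ring.
by apply: (poly_idealB Kid); apply: (poly_idealM Kid).
Qed.
End Flip.

Section NoFlip.
Hypothesis flipF : flip = false.
Let f : {poly int} := 1 + 'X^m + 'X^(2 * m) - 'X^k' - 'X^(m + k').
Let g : {poly int} := 1 + 'X^(3 * m).

Let n6 : n = 6. Proof. by rewrite nE flipF. Qed.
Let gE : g = 1 + u ^+ 3. Proof. by rewrite /g mulnC exprM. Qed.
Let geomE : geom m n = (1 + u + u ^+ 2) * g.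
Proof. by rewrite n6 gE !geomS /geom !big_ord0 -/u; ring. Qed.

(** Modulo [g] one has [u^3 = -1], hence [X^(4m) = -u]; with [X^(a+k') = u] this gives
    [X^k' D = u f]. *)
Lemma rel_geom6 : K g ->
  [/\ K ('X^(n * m) - 1), K (geom m n) & K ('X^k' * D - u * f)].
Proof.
move=> Kg; have Kgeom : K (geom m n) by rewrite geomE; apply: (poly_idealM Kid).
have KN := geom_XN Kgeom; split=> //.
have K1 : K ('X^(a + k') - 'X^m).
  apply: Xn_k' => //; rewrite flipF; apply/eqP.
  by rewrite -[X in (_ == X %[mod _])%Z](subrK k m%:Z) eqz_modDl; apply/eqP.
have K2 : K ('X^(a + 3 * m + b) - 'X^(4 * m)).
  by apply: Xn_tail => //; rewrite n6; lia.
have -> : 'X^k' * D - u * f = (1 + u + u ^+ 2) * ('X^(a + k') - 'X^m) +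
    'X^k' * (1 + u) * ('X^(a + 3 * m + b) - 'X^(4 * m)) + 'X^k' * (1 + u) * u * g.
  rewrite rel_weight_geom /f gE -/u (exprD _ m) (exprD _ a k') -/u.
  by rewrite (mulnC 2) (mulnC 4) !(exprM _ m) -/u; ring.
by apply: (poly_idealD Kid); [apply: (poly_idealD Kid)|] => //; apply: (poly_idealM Kid).
Qed.

Lemma ideal6_min : K (('X - 1) * geom m n) -> K (D - geom m n) -> K f /\ K g.
Proof.
move=> KX KD; have Kgeom := geom_in KX KD; have KN := geom_XN Kgeom.
have {}KD : K D by rewrite -(subrK (geom m n) D); apply: (poly_idealD Kid).
suff Kg : K g.
  split=> //; have [_ _ KDf] := rel_geom6 Kg.
  apply: (@Xn_cancel m) => //; rewrite -/u -[_ * f](subKr ('X^k' * D)).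
  by apply: (poly_idealB Kid) => //; apply: (poly_idealM Kid).
apply: (@Xn_cancel (a + 3 * m + b + 2 * m)) => //.
(* Here [T = (1 + u + u^2) g], and the term of [D] in [1 + u] falls short of it by [u^2 g]. *)
have -> : 'X^(a + 3 * m + b + 2 * m) * g =
    ('X^a + 'X^(a + 3 * m + b)) * geom m n - g * D.
  by rewrite rel_weight_geom geomE (exprD _ _ (2 * m)) (mulnC 2) (exprM _ m) -/u; ring.
by apply: (poly_idealB Kid); apply: (poly_idealM Kid).
Qed.
End NoFlip.
End Relations.

(** * The two derived quotients *)

Lemma derived_quotient_J4 (m : nat) (k : int) (k' : nat) :
  (0 < m)%N -> (k'%:Z = k %[mod (4 * m)%N%:Z])%Z ->
  let r := resultant (1 + 'X^m - 'X^k' : {poly int}) (1 + 'X^(2 * m)) in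
  r != 0 -> derived_quotient (J 4 m k) #= `I_(`|r|%N).
Proof.
set f : {poly int} := 1 + 'X^m - _; set g : {poly int} := 1 + _.
move=> m_gt0 k'E r rn0.
have fn0 : f != 0 by apply/eqP => /(congr1 (fun p => p.[1])); rewrite !hornerE !expr1n.
have gmon : g \is monic by rewrite /g addrC monicXnaddC // muln_gt0.
have [c [c_lt c_surj cE]] := ideal_residues gmon fn0 rn0.
have Iid := ideal2_ideal f g.
have [I_XN I_geom I_relf] :=
  rel_geom4 (n := 4) (flip := true) m_gt0 erefl k'E Iid isT (ideal2r f g).
apply: (derived_quotient_card (n := 4) (flip := true) m_gt0 erefl Iid I_XN I_geom _ _
  c_lt c_surj cE).
  rewrite -[rel_weight _ _ _ _](addrK f).
  by apply: (poly_idealB Iid) => //; apply: ideal2l.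
move=> K Kid KX KD; split; first exact: (geom_in (n := 4) (flip := true) erefl Kid KX KD).
have [Kf Kg] := ideal4_min (n := 4) (flip := true) m_gt0 erefl k'E Kid isT KX KD.
by move=> p; apply: ideal2_min.
Qed.

Lemma derived_quotient_J6 (m : nat) (k : int) (k' : nat) :
  (0 < m)%N -> (k'%:Z = k %[mod (6 * m)%N%:Z])%Z ->
  let r := resultant (1 + 'X^m + 'X^(2 * m) - 'X^k' - 'X^(m + k') : {poly int})
                     (1 + 'X^(3 * m)) in
  r != 0 -> derived_quotient (J 6 m k) #= `I_(`|r|%N).
Proof.
set f : {poly int} := 1 + 'X^m + _ - _ - _; set g : {poly int} := 1 + _.
move=> m_gt0 k'E r rn0.
have fn0 : f != 0 by apply/eqP => /(congr1 (fun p => p.[1])); rewrite !hornerE !expr1n.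
have gmon : g \is monic by rewrite /g addrC monicXnaddC // muln_gt0.
have [c [c_lt c_surj cE]] := ideal_residues gmon fn0 rn0.
have Iid := ideal2_ideal f g.
have [I_XN I_geom I_relf] :=
  rel_geom6 (n := 6) (flip := false) m_gt0 erefl k'E Iid erefl (ideal2r f g).
apply: (derived_quotient_card (n := 6) (flip := false) m_gt0 erefl Iid I_XN I_geom _ _
  c_lt c_surj cE).
  (* [rel_geom6] controls [D] only after multiplication by [X^k']. *)
  apply: (Xn_cancel (n := 6) (flip := false) (i := k') m_gt0 erefl Iid I_XN).
  rewrite -['X^k' * _](subrK ('X^m * f)).
  by apply: (poly_idealD Iid) => //; apply: (poly_idealM Iid); apply: ideal2l.
move=> K Kid KX KD; split; first exact: (geom_in (n := 6) (flip := false) erefl Kid KX KD).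
have [Kf Kg] := ideal6_min (n := 6) (flip := false) m_gt0 erefl k'E Kid erefl KX KD.
by move=> p; apply: ideal2_min.
Qed.

(** The expression equals [(x - y)^2 + 2 x y (1 - cos t)]. It makes the closed forms positive, hence
    the resultants nonzero. *)
Lemma law_of_cosines_gt0 (R : realType) (x y t : R) :
  0 < x -> 0 < y -> x != y -> 0 < x ^+ 2 + y ^+ 2 - 2 * (x * y) * cos t.
Proof.
move=> x0 y0 xy; have c1 := cos_le1 t.
have : 0 < (x - y) ^+ 2 by rewrite exprn_even_gt0 //= subr_eq0.
have : 0 <= (x * y) * (1 - cos t) by rewrite mulr_ge0 ?mulr_ge0 ?subr_ge0 // ltW.
nra.
Qed.

Lemma sqr_root_Xn (R : realType) (m : nat) (d : R) : 0 <= d ->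
  (Num.sqrt d ^+ m) ^+ 2 = d ^+ m.
Proof. by move=> d0; rewrite -exprM mulnC exprM sqr_sqrtr. Qed.

Theorem theorem3 (R : realType) (m : nat) (k : int) :
  (0 < m)%N -> coprimez m%:Z k ->
  (exists a4 : nat,
    [/\ derived_quotient (J 4 m k) #= `I_a4,
        forall k' : nat,
          (k'%:Z = k %[mod (4 * m)%N%:Z])%Z ->
          a4%:Z = `|resultant (1 + 'X^m - 'X^k' : {poly int}) (1 + 'X^(2 * m))|,
        a4%:R = \big[*%R/1]_(l \in [set l : R[i] | l ^+ (2 * m) = -1])
                  `|1 + l ^+ m - l ^ k|
      & a4%:R = 2 ^+ m + 1 - 2 * Num.sqrt 2 ^+ m *
                  cos ((2 * k - m%:Z)%:~R * pi / 4) :> R]) /\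
  (exists a6 : nat,
    [/\ derived_quotient (J 6 m k) #= `I_a6,
        forall k' : nat, (k'%:Z = k %[mod (6 * m)%N%:Z])%Z ->
          a6%:Z = `|resultant
                     (1 + 'X^m + 'X^(2 * m) - 'X^k' - 'X^(m + k') : {poly int})
                     (1 + 'X^(3 * m))|,
        a6%:R = \big[*%R/1]_(l \in [set l : R[i] | l ^+ (3 * m) = -1])
                  `|1 + l ^+ m + l ^+ (2 * m) - l ^ k * (1 + l ^+ m)|
      & a6%:R = 3 ^+ m + 4 ^+ m - 2 * (2 * Num.sqrt 3) ^+ m *
                  cos ((2 * k - m%:Z)%:~R * pi / 6) :> R]).
Proof.
move=> m_gt0 mk.
(* The natural residue of [k] gives one admissible [k'], with which the order is defined. *)
have modK N : (0 < N)%N -> (`|(k %% N%:Z)%Z|%N%:Z = k %[mod N%:Z])%Z.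
  by move=> N0; rewrite gez0_abs ?modz_mod // modz_ge0 // -lt0n.
have expn_neq (x y : R) : 0 < x < y -> x ^+ m != y ^+ m.
  move=> /andP[x0 xy]; by rewrite lt_eqF // ltr_pXn2r ?nnegrE ?(ltW x0) // ltW // (lt_trans x0).
have sqrt_gt1 d : 1 < d -> 1 < Num.sqrt d :> R.
  by move=> d1; rewrite -sqrtr1 ltr_sqrt // (lt_trans ltr01).
have sqrt3_lt2 : Num.sqrt 3 < 2 :> R.
  by rewrite -[ltRHS]ger0_norm // -sqrtr_sqr ltr_sqrt //; lra.
split.
  have /modK k0E : (0 < 4 * m)%N by rewrite muln_gt0.
  have [P1 P2] := resultant4 (R := R) m_gt0 mk k0E.
  set k0 := `|_|%N in P1 P2 k0E.
  exists `|resultant (1 + 'X^m - 'X^k0 : {poly int}) (1 + 'X^(2 * m))|%N.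
  split.
  - apply: derived_quotient_J4 => //; apply: contraTneq isT => r0; exfalso.
    move: P2; rewrite r0 normr0 => /esym/eqP; rewrite gt_eqF //.
    have := @law_of_cosines_gt0 R (Num.sqrt 2 ^+ m) 1 ((2 * k - m%:Z)%:~R * pi / 4).
    rewrite sqr_root_Xn // expr1n mulr1; apply => //.
      by rewrite exprn_gt0 // sqrtr_gt0.
    by rewrite eq_sym -[X in X != _](expr1n _ m) expn_neq // ltr01 sqrt_gt1 ?ltr1n.
  (* The closed form does not involve [k'], so all admissible exponents give the same absolute
     resultant. *)
  - move=> k' k'E; have [_ Q2] := resultant4 (R := R) m_gt0 mk k'E.
    by apply/eqP; rewrite -(eqr_int R) abszE P2 Q2.
  - by rewrite pmulrn abszE P1.
  - by rewrite pmulrn abszE P2.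
have /modK k0E : (0 < 6 * m)%N by rewrite muln_gt0.
have [P1 P2] := resultant6 (R := R) m_gt0 mk k0E.
set k0 := `|_|%N in P1 P2 k0E.
exists `|resultant (1 + 'X^m + 'X^(2 * m) - 'X^k0 - 'X^(m + k0) : {poly int}) (1 + 'X^(3 * m))|%N.
split.
- apply: derived_quotient_J6 => //; apply: contraTneq isT => r0; exfalso.
  move: P2; rewrite r0 normr0 => /esym/eqP; rewrite gt_eqF //.
  have := @law_of_cosines_gt0 R (Num.sqrt 3 ^+ m) (2 ^+ m) ((2 * k - m%:Z)%:~R * pi / 6).
  have -> : (2 ^+ m) ^+ 2 = 4 ^+ m :> R by rewrite -exprM mulnC exprM; congr (_ ^+ m); ring.
  rewrite sqr_root_Xn // -exprMn [Num.sqrt 3 * 2]mulrC; apply.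
  - by rewrite exprn_gt0 // sqrtr_gt0.
  - by rewrite exprn_gt0.
  - by rewrite expn_neq // sqrtr_gt0 ltr0n /= sqrt3_lt2.
- move=> k' k'E; have [_ Q2] := resultant6 (R := R) m_gt0 mk k'E.
  by apply/eqP; rewrite -(eqr_int R) abszE P2 Q2.
- by rewrite pmulrn abszE P1.
- by rewrite pmulrn abszE P2.
Qed.
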